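(* Let $R$ be a commutative ring with $1$, $q\in R$ invertible, $\mathcal{H}=\mathcal{H}_{R,q}(\mathfrak{S}_n)$, and let $\mu=(\mu_1,\ldots,\mu_b)$ be a partition of $n$. Let $\mathcal{I}$ be the right ideal of $\mathcal{H}$ generated by $\{m_\mu h_{d,t} \mid 1\le d<b \text{ and } 1\le t\le \mu_{d+1}\}$. Then $$\mathcal{I}=M^\mu\cap\mathcal{H}^{\rhd\mu}.$$
   Context: Hecke algebra: $\mathcal{H}=\mathcal{H}_{R,q}(\mathfrak{S}_n)$ is the unital associative $R$-algebra with generators $T_1,\ldots,T_{n-1}$ and relations $T_iT_j=T_jT_i$ ($1\le i<j-1\le n-2$), $T_iT_{i+1}T_i=T_{i+1}T_iT_{i+1}$ ($1\le i\le n-2$), $(T_i+1)(T_i-q)=0$ ($1\le i\le n-1$). Permutations act on the right (products are read left to right). If $w=(i_1,i_1+1)\cdots(i_k,i_k+1)$ with $k$ minimal, then $T_w=T_{i_1}\cdots T_{i_k}$ and $\ell(w)=k$; $\{T_w\}$ is an $R$-basis of $\mathcal{H}$. Compositions and tableaux: a composition of $n$ is a finite sequence of non-negative integers with sum $n$; a partition is a weakly decreasing composition. $\lambda\unrhd\mu$ means $\sum_{i\le j}\lambda_i\ge\sum_{i\le j}\mu_i$ for all $j$; $\lambda\rhd\mu$ means in addition $\lambda\ne\mu$. $[\mu]=\{(r,c)\mid 1\le c\le\mu_r\}$. $\mathcal{T}(\mu)$ is the set of fillings of $[\mu]$ containing each of $1,\ldots,n$ exactly once; $\mathfrak{t}^\mu\in\mathcal{T}(\mu)$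 has $1,\ldots,n$ entered in order along the rows, from top to bottom. $\mathfrak{S}_n$ acts on the right on $\mathcal{T}(\mu)$ by permuting entries; $d(\mathfrak{t})$ is defined by $\mathfrak{t}=\mathfrak{t}^\mu d(\mathfrak{t})$. $\mathfrak{S}_\mu$ is the row stabilizer of $\mathfrak{t}^\mu$. $\mathfrak{t}\in\mathcal{T}(\mu)$ is row-standard if entries increase along rows; for $\mu$ a partition it is standard if moreover entries increase down columns; $\mathrm{Std}(\mu)$ is the set of standard $\mu$-tableaux. Modules: $m_\mu=\sum_{w\in\mathfrak{S}_\mu}T_w$ and $M^\mu=m_\mu\mathcal{H}$. Let $*$ be the anti-automorphism of $\mathcal{H}$ with $T_i^*=T_i$, and for row-standard $\nu$-tableaux $\mathfrak{s},\mathfrak{t}$ put $m_{\mathfrak{s}\mathfrak{t}}=T_{d(\mathfrak{s})}^*m_\nu T_{d(\mathfrak{t})}$. For a partition $\mu$ of $n$, $\mathcal{H}^{\rhd\mu}$ is the $R$-span of all $m_{\mathfrak{s}\mathfrak{t}}$ with $\mathfrak{s},\mathfrak{t}\in\mathrm{Std}(\nu)$ for some partition $\nu$ of $n$ with $\nu\rhd\mu$; it is a two-sided ideal. The elements $h_{d,t}$: for a composition $\eta=(\eta_1,\ldots,\eta_l)$ put $\bar\eta_k=\sum_{i=1}^k\eta_i$. For $m\ge0$ let $\mathfrak{t}$ be the $\eta$-tableau with $m+1,\ldots,m+\bar\eta_l$ entered in order along its rows, let $\mathcal{D}_{m,\eta}$ be the set of permutations $w$ of $\{m+1,\ldots,m+\bar\eta_l\}$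 such that $\mathfrak{t}w$ is row-standard, and let $C(m;\eta_1,\ldots,\eta_l)=\sum_{w\in\mathcal{D}_{m,\eta}}T_w$. For $1\le d<b$ and $1\le t\le\mu_{d+1}$, $h_{d,t}=C(\bar\mu_{d-1};\mu_d,t)$. *)

(* Defs.v *)
From HB Require Import structures.
From mathcomp Require Import all_boot all_order all_algebra all_fingroup.
From mathcomp Require Import generic_quotient.
From mathcomp Require Import boolp classical_sets.

Set Implicit Arguments.
Unset Strict Implicit.
Unset Printing Implicit Defensive.

Import GRing.Theory.
Local Open Scope ring_scope.
Local Open Scope quotient_scope.
Local Open Scope classical_set_scope.

(* The Hecke algebra is the algebra of formal expressions over the generators
   modulo the least congruence containing the axioms of R-algebras and the
   defining relations.  The generators T_1, ..., T_(n-1) are indexed by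
   'I_n.-1, so that hT i below stands for T_(i+1).  MathComp's algType
   excludes the zero ring; R may be the zero ring here, so the algebra carries
   a pzRingType and an lmodType structure, linked by hecke_scalerAl and
   hecke_scalerAr. *)
Inductive hterm (R : Type) (n : nat) : Type :=
| HGen of 'I_n.-1
| HScal of R
| HAdd of hterm R n & hterm R n
| HMul of hterm R n & hterm R n.

Arguments HGen {R n} i.
Arguments HScal {R n} c.

HB.instance Definition _ (R : Type) (n : nat) := gen_eqMixin (hterm R n).
HB.instance Definition _ (R : Type) (n : nat) := gen_choiceMixin (hterm R n).

Inductive hcong (R : comPzRingType) (q : R) (n : nat) :
    hterm R n -> hterm R n -> Prop :=
| hc_refl x : hcong q x x
| hc_sym x y : hcong q x y -> hcong q y x
| hc_trans x y z : hcong q x y -> hcong q y z -> hcong q x z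
| hc_add x x' y y' :
    hcong q x x' -> hcong q y y' -> hcong q (HAdd x y) (HAdd x' y')
| hc_mul x x' y y' :
    hcong q x x' -> hcong q y y' -> hcong q (HMul x y) (HMul x' y')
| hc_addA x y z : hcong q (HAdd x (HAdd y z)) (HAdd (HAdd x y) z)
| hc_addC x y : hcong q (HAdd x y) (HAdd y x)
| hc_add0 x : hcong q (HAdd (HScal 0) x) x
| hc_addN x : hcong q (HAdd (HMul (HScal (-1)) x) x) (HScal 0)
| hc_mulA x y z : hcong q (HMul x (HMul y z)) (HMul (HMul x y) z)
| hc_mul1 x : hcong q (HMul (HScal 1) x) x
| hc_mulDl x y z : hcong q (HMul (HAdd x y) z) (HAdd (HMul x z) (HMul y z))
| hc_mulDr x y z : hcong q (HMul x (HAdd y z)) (HAdd (HMul x y) (HMul x z))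
| hc_scalD a b : hcong q (HScal (a + b)) (HAdd (HScal a) (HScal b))
| hc_scalM a b : hcong q (HScal (a * b)) (HMul (HScal a) (HScal b))
| hc_scalC a x : hcong q (HMul (HScal a) x) (HMul x (HScal a))
| hc_comm (i j : 'I_n.-1) : (i.+1 < j)%N ->
    hcong q (HMul (HGen i) (HGen j)) (HMul (HGen j) (HGen i))
| hc_braid (i j : 'I_n.-1) : j = i.+1 :> nat ->
    hcong q (HMul (HMul (HGen i) (HGen j)) (HGen i))
            (HMul (HMul (HGen j) (HGen i)) (HGen j))
| hc_quad (i : 'I_n.-1) :
    hcong q (HMul (HAdd (HGen i) (HScal 1)) (HAdd (HGen i) (HScal (- q))))
            (HScal 0).

Section HeckeQuotient.
Context {R : comPzRingType} (q : R) (n : nat).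

Definition hcongb (x y : hterm R n) : bool := `[< hcong q x y >].

Fact hcongb_refl : reflexive hcongb.
Proof. by move=> x; apply/asboolP; apply: hc_refl. Qed.

Fact hcongb_sym : symmetric hcongb.
Proof. by move=> x y; apply/asboolP/asboolP => /hc_sym. Qed.

Fact hcongb_trans : transitive hcongb.
Proof.
move=> y x z /asboolP xy /asboolP yz; apply/asboolP.
exact: hc_trans xy yz.
Qed.

Canonical hcong_equiv := EquivRel hcongb hcongb_refl hcongb_sym hcongb_trans.

Definition hecke : Type := {eq_quot hcong_equiv}.
HB.instance Definition _ := Choice.on hecke.
HB.instance Definition _ := Quotient.on hecke.

Definition hpi (x : hterm R n) : hecke := \pi x.

Lemma hpiP (x y : hterm R n) : hcong q x y <-> hpi x = hpi y.
Proof.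
by split => [xy | /eqmodP/asboolP //]; apply/eqmodP/asboolP.
Qed.

Lemma hecke_ind (P : hecke -> Prop) : (forall x, P (hpi x)) -> forall x, P x.
Proof. by move=> hP; elim/quotW => x; apply: hP. Qed.

Definition hadd (x y : hecke) : hecke := hpi (HAdd (repr x) (repr y)).
Definition hmul (x y : hecke) : hecke := hpi (HMul (repr x) (repr y)).
Definition hscal (c : R) : hecke := hpi (HScal c).

Lemma hcong_repr (x : hterm R n) : hcong q (repr (hpi x)) x.
Proof. by apply/hpiP; rewrite /hpi reprK. Qed.

Lemma haddE (x y : hterm R n) : hadd (hpi x) (hpi y) = hpi (HAdd x y).
Proof. by apply/hpiP; apply: hc_add; apply: hcong_repr. Qed.

Lemma hmulE (x y : hterm R n) : hmul (hpi x) (hpi y) = hpi (HMul x y).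
Proof. by apply/hpiP; apply: hc_mul; apply: hcong_repr. Qed.

Fact haddA : associative hadd.
Proof.
elim/hecke_ind => x; elim/hecke_ind => y; elim/hecke_ind => z.
by rewrite !haddE; apply/hpiP; apply: hc_addA.
Qed.

Fact haddC : commutative hadd.
Proof.
elim/hecke_ind => x; elim/hecke_ind => y.
by rewrite !haddE; apply/hpiP; apply: hc_addC.
Qed.

Fact hadd0 : left_id (hscal 0) hadd.
Proof. by elim/hecke_ind => x; rewrite haddE; apply/hpiP; apply: hc_add0. Qed.

Fact haddN : left_inverse (hscal 0) (hmul (hscal (-1))) hadd.
Proof.
by elim/hecke_ind => x; rewrite hmulE haddE; apply/hpiP; apply: hc_addN.
Qed.

Fact hmulA : associative hmul.
Proof.
elim/hecke_ind => x; elim/hecke_ind => y; elim/hecke_ind => z.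
by rewrite !hmulE; apply/hpiP; apply: hc_mulA.
Qed.

Fact hscalC c x : hmul (hscal c) x = hmul x (hscal c).
Proof.
by elim/hecke_ind: x => x; rewrite !hmulE; apply/hpiP; apply: hc_scalC.
Qed.

Fact hmul1l : left_id (hscal 1) hmul.
Proof. by elim/hecke_ind => x; rewrite hmulE; apply/hpiP; apply: hc_mul1. Qed.

Fact hmul1r : right_id (hscal 1) hmul.
Proof. by move=> x; rewrite -hscalC hmul1l. Qed.

Fact hmulDl : left_distributive hmul hadd.
Proof.
elim/hecke_ind => x; elim/hecke_ind => y; elim/hecke_ind => z.
by rewrite !(haddE, hmulE); apply/hpiP; apply: hc_mulDl.
Qed.

Fact hmulDr : right_distributive hmul hadd.
Proof.
elim/hecke_ind => x; elim/hecke_ind => y; elim/hecke_ind => z.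
by rewrite !(haddE, hmulE); apply/hpiP; apply: hc_mulDr.
Qed.

HB.instance Definition _ := GRing.isPzRing.Build hecke
  haddA haddC hadd0 haddN hmulA hmul1l hmul1r hmulDl hmulDr.

Lemma hpiD (x y : hterm R n) : hpi (HAdd x y) = hpi x + hpi y.
Proof. exact/esym/haddE. Qed.

Lemma hpiM (x y : hterm R n) : hpi (HMul x y) = hpi x * hpi y.
Proof. exact/esym/hmulE. Qed.

Fact hscalD a b : hscal (a + b) = hscal a + hscal b.
Proof. by rewrite -hpiD; apply/hpiP; apply: hc_scalD. Qed.

Fact hscalM a b : hscal (a * b) = hscal a * hscal b.
Proof. by rewrite -hpiM; apply/hpiP; apply: hc_scalM. Qed.

Definition hscale (c : R) (x : hecke) : hecke := hscal c * x.

Fact hscaleA a b v : hscale a (hscale b v) = hscale (a * b) v.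
Proof. by rewrite /hscale hscalM mulrA. Qed.

Fact hscale1 : left_id 1 hscale.
Proof. by move=> v; rewrite /hscale mul1r. Qed.

Fact hscaleDr : right_distributive hscale +%R.
Proof. by move=> c v w; rewrite /hscale mulrDr. Qed.

Fact hscaleDl v : {morph hscale^~ v : a b / a + b}.
Proof. by move=> a b; rewrite /hscale hscalD mulrDl. Qed.

HB.instance Definition _ := GRing.Zmodule_isLmodule.Build R hecke
  hscaleA hscale1 hscaleDr hscaleDl.

Lemma hecke_scalerAl (c : R) (x y : hecke) : c *: (x * y) = (c *: x) * y.
Proof. exact: mulrA. Qed.

Lemma hecke_scalerAr (c : R) (x y : hecke) : c *: (x * y) = x * (c *: y).
Proof.
by rewrite /GRing.scale /= /hscale mulrA [hscal c * x]hscalC -mulrA.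
Qed.

Definition hT (i : 'I_n.-1) : hecke := hpi (HGen i).

Lemma hT_comm (i j : 'I_n.-1) : (i.+1 < j)%N -> hT i * hT j = hT j * hT i.
Proof. by move=> /(hc_comm q)/hpiP; rewrite !hpiM. Qed.

Lemma hT_braid (i j : 'I_n.-1) : j = i.+1 :> nat ->
  hT i * hT j * hT i = hT j * hT i * hT j.
Proof.
by move=> /(hc_braid q)/hpiP; rewrite !hpiM.
Qed.

Lemma hT_quad (i : 'I_n.-1) : (hT i + 1) * (hT i - q *: (1 : hecke)) = 0.
Proof.
have -> : - (q *: (1 : hecke)) = hscal (- q).
  by rewrite -scaleNr; apply: hmul1r.
by have /hpiP := hc_quad q i; rewrite hpiM !hpiD.
Qed.

Fixpoint htrev (x : hterm R n) : hterm R n :=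
  match x with
  | HGen i => HGen i
  | HScal c => HScal c
  | HAdd x y => HAdd (htrev x) (htrev y)
  | HMul x y => HMul (htrev y) (htrev x)
  end.

Lemma htrev_cong (x y : hterm R n) : hcong q x y -> hcong q (htrev x) (htrev y).
Proof.
elim=> {x y} /=.
- by move=> *; apply: hc_refl.
- by move=> *; apply: hc_sym.
- by move=> ? ? ? _ h1 _ h2; apply: hc_trans h1 h2.
- by move=> *; apply: hc_add.
- by move=> *; apply: hc_mul.
- by move=> *; apply: hc_addA.
- by move=> *; apply: hc_addC.
- by move=> *; apply: hc_add0.
- move=> x; apply: hc_trans (hc_addN q (htrev x)); apply: hc_add.
    exact/hc_sym/hc_scalC.
  exact: hc_refl.
- by move=> *; apply/hc_sym/hc_mulA.
- by move=> x; apply: hc_trans (hc_mul1 q (htrev x)); apply/hc_sym/hc_scalC.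
- by move=> *; apply: hc_mulDr.
- by move=> *; apply: hc_mulDl.
- by move=> *; apply: hc_scalD.
- by move=> a b; rewrite mulrC; apply: hc_scalM.
- by move=> *; apply/hc_sym/hc_scalC.
- by move=> *; apply/hc_sym/hc_comm.
- move=> i j ij; apply: hc_trans (hc_mulA _ _ _ _) _.
  by apply: hc_trans (hc_braid q ij) _; apply/hc_sym/hc_mulA.
move=> i; apply: hc_trans (hc_quad q i); apply/hpiP.
rewrite !(hpiM, hpiD).
suff: GRing.comm (hpi (HGen i) + hscal (- q)) (hpi (HGen i) + 1) by [].
apply: commrD; last exact: commr1.
apply/commr_sym/commrD => //; exact/commr_sym/hscalC.
Qed.

Definition hstar (x : hecke) : hecke := hpi (htrev (repr x)).

Lemma hstarE (x : hterm R n) : hstar (hpi x) = hpi (htrev x).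
Proof. by apply/hpiP/htrev_cong/hcong_repr. Qed.

Lemma hstarT (i : 'I_n.-1) : hstar (hT i) = hT i.
Proof. exact: hstarE. Qed.

Lemma hstarD (x y : hecke) : hstar (x + y) = hstar x + hstar y.
Proof.
elim/hecke_ind: x => x; elim/hecke_ind: y => y.
by rewrite -hpiD !hstarE -hpiD.
Qed.

Lemma hstarM (x y : hecke) : hstar (x * y) = hstar y * hstar x.
Proof.
elim/hecke_ind: x => x; elim/hecke_ind: y => y.
by rewrite -hpiM !hstarE -hpiM.
Qed.

Lemma hstar_scal (c : R) : hstar (hscal c) = hscal c.
Proof. exact: hstarE. Qed.

Lemma hstarZ (c : R) (x : hecke) : hstar (c *: x) = c *: hstar x.
Proof. by rewrite [LHS]hstarM hstar_scal -[LHS]hscalC. Qed.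

Lemma hstarK : involutive hstar.
Proof.
elim/hecke_ind => x; rewrite !hstarE; congr hpi.
by elim: x => //= [x -> y -> | x -> y ->].
Qed.

End HeckeQuotient.

(* The universal property: an R-algebra is a ring A with a ring morphism
   phi : R -> A whose image is central. *)
Lemma hecke_lift (R : comPzRingType) (q : R) (n : nat) (A : pzRingType)
    (phi : {rmorphism R -> A}) (U : 'I_n.-1 -> A) :
    (forall c a, phi c * a = a * phi c) ->
    (forall i j : 'I_n.-1, (i.+1 < j)%N -> U i * U j = U j * U i) ->
    (forall i j : 'I_n.-1, j = i.+1 :> nat -> U i * U j * U i = U j * U i * U j) ->
    (forall i, (U i + 1) * (U i - phi q) = 0) ->
  exists2 f : {rmorphism hecke q n -> A},
    (forall i, f (hT q i) = U i) /\ (forall c x, f (c *: x) = phi c * f x) &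
    forall g : {rmorphism hecke q n -> A},
      (forall i, g (hT q i) = U i) ->
      (forall c x, g (c *: x) = phi c * g x) -> f =1 g.
Proof.
move=> phiC Ucomm Ubraid Uquad.
pose ev := fix ev (x : hterm R n) : A :=
  match x with
  | HGen i => U i
  | HScal c => phi c
  | HAdd x y => ev x + ev y
  | HMul x y => ev x * ev y
  end.
have evP x y : hcong q x y -> ev x = ev y.
  elim=> //=.
  - by move=> ? ? ? _ -> _ ->.
  - by move=> ? ? ? ? _ -> _ ->.
  - by move=> ? ? ? ? _ -> _ ->.
  - by move=> *; rewrite addrA.
  - by move=> *; rewrite addrC.
  - by move=> *; rewrite rmorph0 add0r.
  - by move=> z; rewrite rmorphN rmorph1 mulN1r addNr rmorph0.
  - by move=> *; rewrite mulrA.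
  - by move=> *; rewrite rmorph1 mul1r.
  - by move=> *; rewrite mulrDl.
  - by move=> *; rewrite mulrDr.
  - by move=> *; rewrite rmorphD.
  - by move=> *; rewrite rmorphM.
  - by move=> i; rewrite rmorph1 rmorphN rmorph0.
pose f (x : hecke q n) := ev (repr x).
have fE x : f (hpi q x) = ev x by apply/evP/hcong_repr.
have f0 : f 0 = 0 by rewrite [LHS]fE /= rmorph0.
have fD : {morph f : x y / x + y}.
  elim/(@hecke_ind R q n) => x; elim/(@hecke_ind R q n) => y.
  by rewrite -hpiD !fE.
have f1 : f 1 = 1 by rewrite [LHS]fE /= rmorph1.
have fM : {morph f : x y / x * y}.
  elim/(@hecke_ind R q n) => x; elim/(@hecke_ind R q n) => y.
  by rewrite -hpiM !fE.
pose fA := GRing.isNmodMorphism.Build _ _ f (f0, fD).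
pose fMm := GRing.isMonoidMorphism.Build _ _ f (f1, fM).
pose F : {rmorphism hecke q n -> A} := HB.pack f fA fMm.
exists F.
  split=> [i | c x]; first exact: fE.
  by rewrite [LHS]fM; congr (_ * _); apply: fE.
move=> g gT gZ; elim/(@hecke_ind R q n) => x; rewrite [LHS]fE.
elim: x => [i | c | x IHx y IHy | x IHx y IHy] /=.
- exact/esym/gT.
- have -> : hpi q (HScal c) = c *: (1 : hecke q n) by apply/esym/hmul1r.
  by rewrite gZ rmorph1 mulr1.
- by rewrite IHx IHy hpiD rmorphD.
- by rewrite IHx IHy hpiM rmorphM.
Qed.

(* Compositions are sequences of parts, trailing zeros being allowed, and
   positions and entries are counted from 0: the box (r, c) below is the box
   (r + 1, c + 1) of the mathematical text, and the entry k stands for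
   k + 1. *)
Definition is_partition (n : nat) (mu : seq nat) : Prop :=
  sorted geq mu /\ sumn mu = n.

Definition dominates (la mu : seq nat) : Prop :=
  forall j, (sumn (take j mu) <= sumn (take j la))%N.

(* Partitions differing only by trailing zeros are the same partition, so
   "la <> mu" is read on the sequences padded with zeros. *)
Definition strictly_dominates (la mu : seq nat) : Prop :=
  dominates la mu /\ exists j, nth 0%N la j <> nth 0%N mu j.

Definition box (mu : seq nat) : finType :=
  {r : 'I_(size mu) & 'I_(nth 0%N mu r)}.

Definition brow (mu : seq nat) (x : box mu) : nat := tag x.
Definition bcol (mu : seq nat) (x : box mu) : nat := tagged x.

Definition filling (mu : seq nat) : Type := box mu -> nat.

Definition is_tableau (n : nat) (mu : seq nat) (t : filling mu) : Prop :=
  injective t /\ forall k, (k < n)%N <-> exists x, t x = k.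

(* The filling by m, m + 1, ... in order along the rows; t^mu is the case
   m = 0. *)
Definition initial_filling (m : nat) (mu : seq nat) : filling mu :=
  fun x => (m + sumn (take (brow x) mu) + bcol x)%N.

Definition perm_nat (n : nat) (w : 'S_n) (k : nat) : nat :=
  oapp (fun i : 'I_n => val (w i)) k (insub k).

Definition act_filling (n : nat) (mu : seq nat) (t : filling mu) (w : 'S_n) :
    filling mu := fun x => perm_nat w (t x).

Definition row_standard (mu : seq nat) (t : filling mu) : bool :=
  [forall x, forall y, (brow x == brow y) && (bcol x < bcol y)%N ==>
                       (t x < t y)%N].

Definition column_standard (mu : seq nat) (t : filling mu) : bool :=
  [forall x, forall y, (bcol x == bcol y) && (brow x < brow y)%N ==>
                       (t x < t y)%N].

Definition Std (n : nat) (mu : seq nat) : set (filling mu) :=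
  [set t | [/\ is_tableau n t, row_standard t & column_standard t]].

(* The permutation d with t = t^mu d (it is unique when t is a tableau). *)
Definition tab_perm (n : nat) (mu : seq nat) (t : filling mu) : 'S_n :=
  odflt 1%g
    [pick d | [forall x, t x == act_filling (@initial_filling 0 mu) d x]].

Definition row_stabilizer (n : nat) (mu : seq nat) : {set 'S_n} :=
  [set w : 'S_n | [forall x : box mu, exists y : box mu, (brow x == brow y) &&
     (act_filling (@initial_filling 0 mu) w x == initial_filling 0 y)]].

Lemma ord_pred_proof (n : nat) (i : 'I_n.-1) : (i < n)%N.
Proof. exact: leq_trans (ltn_ord i) (leq_pred n). Qed.

Lemma ord_pred_succ_proof (n : nat) (i : 'I_n.-1) : (i.+1 < n)%N.
Proof. by rewrite -ltn_predRL. Qed.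

Definition simple_transp (n : nat) (i : 'I_n.-1) : 'S_n :=
  tperm (Ordinal (ord_pred_proof i)) (Ordinal (ord_pred_succ_proof i)).

(* MathComp multiplies permutations from left to right:
   (u * w) i = w (u i). *)
Definition word_perm (n : nat) (s : seq 'I_n.-1) : 'S_n :=
  (\prod_(i <- s) simple_transp i)%g.

Definition reduced_words (n : nat) (w : 'S_n) : set (seq 'I_n.-1) :=
  [set s | word_perm s = w /\
           forall s', word_perm s' = w -> (size s <= size s')%N].

Section Modules.
Context {R : comPzRingType} (q : R) (n : nat).
Local Notation H := (hecke q n).

Definition hTw (w : 'S_n) : H := \prod_(i <- xget [::] (reduced_words w)) hT q i.

Definition span (S : set H) : set H :=
  [set x | exists k (c : 'I_k -> R) (v : 'I_k -> H),
     (forall i, S (v i)) /\ x = \sum_(i < k) c i *: v i].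

Definition right_ideal (S : set H) : set H :=
  [set x | exists k (v a : 'I_k -> H),
     (forall i, S (v i)) /\ x = \sum_(i < k) v i * a i].

Definition m_elt (mu : seq nat) : H := \sum_(w in row_stabilizer n mu) hTw w.

Definition M_mod (mu : seq nat) : set H := [set m_elt mu * h | h in setT].

Definition m_basis (nu : seq nat) (s t : filling nu) : H :=
  hstar (hTw (tab_perm n s)) * m_elt nu * hTw (tab_perm n t).

Definition H_gt (mu : seq nat) : set H :=
  span [set x | exists nu (s t : filling nu),
    [/\ is_partition n nu, strictly_dominates nu mu, Std n s, Std n t &
        x = m_basis s t]].

(* Permutations of {m, ..., m + |eta| - 1} are viewed as permutations of 'I_n
   fixing everything else. *)
Definition D_set (m : nat) (eta : seq nat) : {set 'S_n} :=
  [set w : 'S_n |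
     perm_on [set i : 'I_n | (m <= i < m + sumn eta)%N] w &&
     row_standard (act_filling (@initial_filling m eta) w)].

Definition C_elt (m : nat) (eta : seq nat) : H := \sum_(w in D_set m eta) hTw w.

(* Here d >= 1 counts from 1 as in the mathematical text: the part mu_d is
   nth 0 mu d.-1, and mu_1 + ... + mu_(d-1) is sumn (take d.-1 mu). *)
Definition h_elt (mu : seq nat) (d t : nat) : H :=
  C_elt (sumn (take d.-1 mu)) [:: nth 0%N mu d.-1; t].

End Modules.

Arguments M_mod {R} q n mu _.
Arguments H_gt {R} q n mu _.

(* Main.v *)
(* Both inclusions rest on two facts about a partition mu.

   Straightening: modulo I, the module m_mu H is spanned by the m_mu T_d(t)
   with t standard.  The Garnir sums needed for this lie in I because the
   shuffle sums C(m; a, s) satisfy a Pascal recursion in which, q being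
   invertible, all terms can be traced back to the h_(d,t).  Since
   m_mu h_(d,t) lies in H m_nu, where nu is mu with t boxes moved up one row,
   straightening on both sides and induction along the dominance order put
   H m_nu H inside the span of the Murphy elements of shapes dominating nu;
   hence I is contained in H^(>mu).

   Independence: let y be the antisymmetrizer of the columns of mu numbered
   consecutively, and w the permutation turning the row reading of mu into its
   column reading.  Then m_nu H y = 0 whenever nu strictly dominates mu, while
   m_mu T_z y = 0 for every z <> w with l(z) <= l(w), and m_mu T_w y has
   coefficient 1 at T_w.  Multiplying a combination of the m_mu T_d(t) lying in
   H^(>mu) by the elements T_(d(s)^-1 w) y therefore yields a unitriangular
   system, so all its coefficients vanish. *)
Require Import Defs.
From HB Require Import structures.
From mathcomp Require Import all_boot all_order all_algebra all_fingroup.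
From mathcomp Require Import boolp classical_sets.
From mathcomp Require Import zify ring.

Set Implicit Arguments.
Unset Strict Implicit.
Unset Printing Implicit Defensive.

Import GRing.Theory.
Local Open Scope ring_scope.
Local Open Scope classical_set_scope.

(** * Inversions and reduced words *)

Section Permutations.
Context {n : nat}.
Implicit Types (u v w : 'S_n) (i j : 'I_n.-1) (a b k : 'I_n).

Definition lo i : 'I_n := Ordinal (ord_pred_proof i).
Definition hi i : 'I_n := Ordinal (ord_pred_succ_proof i).
Local Notation s_ i := (simple_transp i).

Definition ascent w i : bool := (w (lo i) < w (hi i))%N.

Definition swap_nat (i k : nat) : nat :=
  if k == i then i.+1 else if k == i.+1 then i else k.

Lemma simple_transpE i k : s_ i k = swap_nat i k :> nat.
Proof.
rewrite /simple_transp /swap_nat; case: tpermP => [-> | -> | ] /=.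
- by rewrite eqxx.
- by rewrite eqxx; case: eqP; lia.
move=> /eqP; rewrite -val_eqE /= => /negPf -> /eqP.
by rewrite -val_eqE /= => /negPf ->.
Qed.

Lemma simple_transpK i : (s_ i * s_ i)%g = 1%g.
Proof. exact: tperm2. Qed.

Lemma simple_transp_mulK i w : (s_ i * (s_ i * w))%g = w.
Proof. by rewrite mulgA simple_transpK mul1g. Qed.

Lemma simple_transpV i : ((s_ i)^-1)%g = s_ i.
Proof. exact: tpermV. Qed.

Lemma simple_transp_lo i : s_ i (lo i) = hi i.
Proof. exact: tpermL. Qed.

Lemma simple_transp_hi i : s_ i (hi i) = lo i.
Proof. exact: tpermR. Qed.

Lemma perm_val_neq w a b : a <> b :> nat -> w a <> w b :> nat.
Proof. by move=> ab /val_inj /perm_inj e; apply: ab; rewrite e. Qed.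

Lemma ascentN w i : ~~ ascent w i -> (w (hi i) < w (lo i))%N.
Proof.
rewrite /ascent; have : w (lo i) <> w (hi i) :> nat.
  by apply: perm_val_neq => /=; lia.
lia.
Qed.

Lemma ascent_simple_transp w i : ascent (s_ i * w)%g i = ~~ ascent w i.
Proof.
rewrite /ascent !permM simple_transp_lo simple_transp_hi.
have : w (lo i) <> w (hi i) :> nat by apply: perm_val_neq => /=; lia.
lia.
Qed.

Lemma gen_exists (k : nat) : (k.+1 < n)%N -> exists i, i = k :> nat.
Proof. by rewrite -ltn_predRL => h; exists (Ordinal h). Qed.

Definition inv_set w : {set 'I_n * 'I_n} :=
  [set p : 'I_n * 'I_n | (p.1 < p.2)%N && (w p.2 < w p.1)%N].

Definition inv w : nat := #|inv_set w|.

Lemma inv_simple_transp w i : ascent w i -> inv (s_ i * w) = (inv w).+1.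
Proof.
move=> asc_wi; pose f (p : 'I_n * 'I_n) := (s_ i p.1, s_ i p.2).
have fK : involutive f.
  by case=> a b; rewrite /f /= -!permM simple_transpK !perm1.
rewrite [inv (s_ i * w)]/inv.
suff -> : inv_set (s_ i * w) = (lo i, hi i) |: (f @^-1: inv_set w).
  rewrite cardsU1 !inE /= simple_transp_lo simple_transp_hi ltnNge leqnSn /=.
  by rewrite add1n card_preimset //; apply: inv_inj.
apply/setP => -[a b]; rewrite !inE /= !permM xpair_eqE.
case: (altP (a =P lo i)) => [-> | /eqP na] /=.
  case: (altP (b =P hi i)) => [-> | /eqP nb] /=.
    by rewrite simple_transp_lo simple_transp_hi leqnn.
  have nb' : b <> i.+1 :> nat by move=> e; apply: nb; apply: val_inj.
  rewrite simple_transp_lo; congr andb; rewrite simple_transpE /swap_nat /=.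
  by do ?case: eqP => //=; lia.
have na' : a <> i :> nat by move=> e; apply: na; apply: val_inj.
case: (altP (a =P hi i)) => [-> | /eqP nh] /=.
  case: (altP (b =P lo i)) => [-> | /eqP nl] /=.
    rewrite simple_transp_lo simple_transp_hi; move: asc_wi; rewrite /ascent.
    by rewrite /=; lia.
  have nl' : b <> i :> nat by move=> e; apply: nl; apply: val_inj.
  rewrite simple_transp_hi; congr andb; rewrite simple_transpE /swap_nat /=.
  by do ?case: eqP => //=; lia.
have nh' : a <> i.+1 :> nat by move=> e; apply: nh; apply: val_inj.
congr andb; rewrite !simple_transpE /swap_nat /=.
by do ?case: eqP => //=; lia.
Qed.

Lemma inv_simple_transpN w i : ~~ ascent w i -> inv w = (inv (s_ i * w)).+1.
Proof.
by rewrite -ascent_simple_transp => /inv_simple_transp <-;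
   rewrite simple_transp_mulK.
Qed.

Lemma inv1 : inv 1%g = 0%N.
Proof.
by apply/eqP; rewrite cards_eq0; apply/eqP/setP => -[a b];
   rewrite !inE /= !perm1; lia.
Qed.

Lemma all_ascents w : (forall i, ascent w i) -> w = 1%g.
Proof.
move=> asc; have mono (a b : 'I_n) : (a <= b)%N -> (w a <= w b)%N.
  move: {2}(b - a)%N (erefl (b - a)%N) => d; elim: d b => [|d IH] b e ab.
    by have -> : a = b by apply: val_inj => /=; lia.
  have hb : (b.-1.+1 < n)%N by have := ltn_ord b; lia.
  have [i ib] := gen_exists hb; have := asc i; rewrite /ascent.
  have -> : hi i = b by apply: val_inj => /=; lia.
  have := IH (lo i); rewrite /=; lia.
have ge (a : 'I_n) : (a <= w a)%N.
  case: a => a; elim: a => [// | a IH] ha.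
  have ha' : (a < n)%N by lia.
  have := IH ha'; have := mono (Ordinal ha') (Ordinal ha); rewrite /=.
  have : w (Ordinal ha') <> w (Ordinal ha) :> nat.
    by apply: perm_val_neq => /=; lia.
  lia.
have le (a : 'I_n) : (w a <= a)%N.
  move: {2}(n - a)%N (erefl (n - a)%N) => d; elim: d a => [|d IH] a e.
    by have := ltn_ord a; lia.
  have [han | han] := leqP n a.+1; first by have := ltn_ord (w a); lia.
  have := IH (Ordinal han); have := mono a (Ordinal han); rewrite /=.
  have : w a <> w (Ordinal han) :> nat by apply: perm_val_neq => /=; lia.
  lia.
by apply/permP => a; rewrite perm1; apply: val_inj => /=; have := ge a;
   have := le a; lia.
Qed.

Lemma perm_ind_left (P : 'S_n -> Prop) : P 1%g ->
  (forall w i, ascent w i -> P w -> P (s_ i * w)%g) -> forall w, P w.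
Proof.
move=> P1 PS w; move: {2}(inv w) (erefl (inv w)) => k.
elim: k w => [|k IH] w e.
  suff -> : w = 1%g by [].
  by apply: all_ascents => i; apply: contraPT isT => /inv_simple_transpN; lia.
case: (pselect (forall i, ascent w i)) => [/all_ascents -> // |].
move=> /existsNP [i /negP wi].
rewrite -(simple_transp_mulK i w); apply: PS.
  by rewrite ascent_simple_transp.
by apply: IH; have := inv_simple_transpN wi; lia.
Qed.

Lemma inv_eq0 w : inv w = 0%N -> w = 1%g.
Proof.
elim/perm_ind_left: w => // w i /inv_simple_transp -> _ //.
Qed.

Lemma word_perm_cons i (r : seq 'I_n.-1) :
  word_perm (i :: r) = (s_ i * word_perm r)%g.
Proof. by rewrite /word_perm big_cons. Qed.

Lemma word_perm_cat (r1 r2 : seq 'I_n.-1) :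
  word_perm (r1 ++ r2) = (word_perm r1 * word_perm r2)%g.
Proof. by rewrite /word_perm big_cat. Qed.

Lemma word_perm_rev (r : seq 'I_n.-1) :
  word_perm (rev r) = ((word_perm r)^-1)%g.
Proof.
elim: r => [|i r IH]; first by rewrite /word_perm big_nil invg1.
rewrite rev_cons -cats1 word_perm_cat IH (word_perm_cons i r) invMg simple_transpV.
by rewrite /word_perm big_seq1.
Qed.

Lemma inv_word (r : seq 'I_n.-1) : (inv (word_perm r) <= size r)%N.
Proof.
elim: r => [|i r IH]; first by rewrite /word_perm big_nil inv1.
rewrite word_perm_cons /=; case: (boolP (ascent (word_perm r) i)).
  by move=> /inv_simple_transp ->.
by move=> /inv_simple_transpN; lia.
Qed.

Lemma word_exists w : exists2 r, word_perm r = w & size r = inv w.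
Proof.
elim/perm_ind_left: w => [|w i wi [r e sr]].
  by exists [::]; rewrite /word_perm ?big_nil ?inv1.
exists (i :: r); first by rewrite word_perm_cons e.
by rewrite /= sr (inv_simple_transp wi).
Qed.

Lemma reduced_wordsP w (r : seq 'I_n.-1) :
  reduced_words w r <-> word_perm r = w /\ size r = inv w.
Proof.
split=> [[e min_r] | [e sr]]; split=> //.
  have [r' e' sr'] := word_exists w.
  by have := min_r r' e'; have := inv_word r; rewrite e; lia.
by move=> r' e'; rewrite sr -e'; apply: inv_word.
Qed.

Lemma invV w : inv w^-1 = inv w.
Proof.
have le u : (inv u^-1 <= inv u)%N.
  have [r <- <-] := word_exists u.
  by rewrite -word_perm_rev -(size_rev r) inv_word.
by apply/eqP; rewrite eqn_leq le -{1}(invgK w) le.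
Qed.

Lemma inv_additive u w : inv_set u \subset inv_set w ->
  (inv u + inv (u^-1 * w))%N = inv w.
Proof.
elim/perm_ind_left: u w => [|u i ui IH] w sub_uw.
  by rewrite inv1 invg1 mul1g.
have wi : ~~ ascent w i.
  have /(fintype.subsetP sub_uw) : (lo i, hi i) \in inv_set (s_ i * u).
    by rewrite inE /= leqnn !permM simple_transp_lo simple_transp_hi.
  by rewrite inE /ascent /=; lia.
rewrite invMg simple_transpV -mulgA inv_simple_transp // addSn IH.
  by rewrite -inv_simple_transpN.
apply/fintype.subsetP => -[a b]; rewrite !inE /= => /andP [ab uab].
have nab : ~ (a = lo i /\ b = hi i).
  by move=> [ea eb]; move: ui uab; rewrite ea eb /ascent; lia.
rewrite ab !permM /=.
have : (s_ i a, s_ i b) \in inv_set (s_ i * u).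
  rewrite inE /= -!permM !mulgA simple_transpK mul1g uab andbT !simple_transpE.
  have : ~ (a = i :> nat /\ b = i.+1 :> nat).
    by move=> [ea eb]; apply: nab; split; apply: val_inj.
  by rewrite /swap_nat; do ?case: eqP => //=; lia.
by move=> /(fintype.subsetP sub_uw); rewrite inE /= => /andP [].
Qed.

End Permutations.

(** * Matsumoto's theorem and the basis T_w *)

Section HeckeBasis.
Context {R : comPzRingType} (q : R) {n : nat}.
Implicit Types (u v w : 'S_n) (i j : 'I_n.-1).
Local Notation H := (hecke q n).
Local Notation s_ i := (simple_transp i).
Local Notation T i := (hT q i).
Local Notation Tw w := (hTw q w).

Lemma simple_transp_comm i j : (i.+1 < j)%N -> (s_ i * s_ j = s_ j * s_ i)%g.
Proof.
move=> ij; apply/permP => k; rewrite !permM; apply: val_inj => /=.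
by rewrite !simple_transpE /swap_nat; do ?case: eqP => //=; lia.
Qed.

Lemma simple_transp_braid i j : j = i.+1 :> nat ->
  (s_ i * (s_ j * s_ i) = s_ j * (s_ i * s_ j))%g.
Proof.
move=> ij; apply/permP => k; rewrite !permM; apply: val_inj => /=.
by rewrite !simple_transpE ij /swap_nat; do ?case: eqP => //=; lia.
Qed.

Lemma ascent_far w i j : (i.+1 < j)%N || (j.+1 < i)%N ->
  ascent (s_ i * w)%g j = ascent w j.
Proof.
move=> ij; rewrite /ascent !permM.
have -> : s_ i (lo j) = lo j.
  apply: val_inj; rewrite /= simple_transpE /swap_nat /=.
  by do ?case: eqP => //=; lia.
have -> // : s_ i (hi j) = hi j.
apply: val_inj; rewrite /= simple_transpE /swap_nat /=.
by do ?case: eqP => //=; lia.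
Qed.

Lemma ascent_next w i j : j = i.+1 :> nat ->
  ascent (s_ i * w)%g j = (w (lo i) < w (hi j))%N.
Proof.
move=> ij; rewrite /ascent !permM.
have -> : s_ i (lo j) = lo i.
  apply: val_inj; rewrite /= simple_transpE /swap_nat /=.
  by do ?case: eqP => //=; lia.
have -> // : s_ i (hi j) = hi j.
apply: val_inj; rewrite /= simple_transpE /swap_nat /=.
by do ?case: eqP => //=; lia.
Qed.

Lemma ascent_prev w i j : j = i.+1 :> nat ->
  ascent (s_ j * w)%g i = (w (lo i) < w (hi j))%N.
Proof.
move=> ij; rewrite /ascent !permM.
have -> : s_ j (hi i) = hi j.
  apply: val_inj; rewrite /= simple_transpE /swap_nat /=.
  by do ?case: eqP => //=; lia.
have -> // : s_ j (lo i) = lo i.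
apply: val_inj; rewrite /= simple_transpE /swap_nat /=.
by do ?case: eqP => //=; lia.
Qed.

Lemma hi_lo i j : j = i.+1 :> nat -> hi i = lo j.
Proof. by move=> ij; apply: val_inj. Qed.

Definition word_T (r : seq 'I_n.-1) : H := \prod_(i <- r) T i.

Lemma word_T_cons i r : word_T (i :: r) = T i * word_T r.
Proof. exact: big_cons. Qed.

Lemma matsumoto (a b : seq 'I_n.-1) :
  size a = inv (word_perm a) -> size b = inv (word_perm b) ->
  word_perm a = word_perm b -> word_T a = word_T b.
Proof.
move: {2}(size a) (erefl (size a)) => k; elim: k a b => [|k IH] a b.
  move=> /size0nil -> _ sb e; rewrite -e /word_perm big_nil inv1 in sb.
  by rewrite (size0nil sb).
case: a => [// | i a] [sk] sa sb e.
case: b sb e => [|j b] sb e.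
  by move: sa; rewrite e -sb.
have red (l : 'I_n.-1) (r : seq 'I_n.-1) : size (l :: r) = inv (word_perm (l :: r)) ->
    ascent (word_perm r) l /\ size r = inv (word_perm r).
  rewrite word_perm_cons /= => h; have hr := inv_word r.
  case: (boolP (ascent (word_perm r) l)) => hl; split=> //.
  - by move: h; rewrite inv_simple_transp // => -[].
  - by have := inv_simple_transpN hl; lia.
  - by have := inv_simple_transpN hl; lia.
wlog ij : i j a b sk sa sb e / (i <= j)%N.
  move=> hw; have [|/ltnW] := leqP i j; first exact: hw.
  move=> ji; apply/esym; apply: (hw _ _ _ _ _ sb sa _ ji) => //.
  have [_ ra] := red _ _ sa; have [_ rb] := red _ _ sb.
  by move: sa sb; rewrite e /= => <- [->].
have [aa ra] := red _ _ sa; have [ab rb] := red _ _ sb.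
have sab : size a = size b by move: sa sb; rewrite e => <- [].
rewrite !word_T_cons.
case: (eqVneq i j) => [eij | nij].
  rewrite eij; congr (_ * _); apply: IH => //.
  move: e; rewrite !word_perm_cons eij => /(congr1 (fun x => s_ j * x)%g).
  by rewrite !simple_transp_mulK.
have {}ij : (i < j)%N by rewrite ltn_neqAle nij.
move: e; rewrite !word_perm_cons; set u := word_perm a; set v := word_perm b.
move=> e; have [w ew] : exists w, w = (s_ i * u)%g by exists (s_ i * u)%g.
rewrite -ew in e; have eu : u = (s_ i * w)%g by rewrite ew simple_transp_mulK.
have ev : v = (s_ j * w)%g by rewrite e simple_transp_mulK.
have wi : ~~ ascent w i by rewrite ew ascent_simple_transp aa.
have wj : ~~ ascent w j by rewrite e ascent_simple_transp ab.
have [far | near] := ltnP i.+1 j.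
  have uj : ~~ ascent u j by rewrite eu ascent_far ?far.
  have [r er sr] := word_exists (s_ j * u)%g.
  have iu := inv_simple_transpN uj.
  have vi : ~~ ascent v i by rewrite ev ascent_far ?far ?orbT.
  have er' : word_perm r = (s_ i * v)%g.
    by rewrite er ev eu !mulgA (simple_transp_comm far).
  have iv := inv_simple_transpN vi.
  rewrite (IH a (j :: r)) ?(IH b (i :: r)) //.
  - by rewrite !word_T_cons !mulrA (hT_comm q far).
  - by rewrite -sab.
  - by rewrite word_perm_cons er' simple_transp_mulK /= sr iv -er' er.
  - by rewrite word_perm_cons er' simple_transp_mulK.
  - by rewrite word_perm_cons er simple_transp_mulK /= sr.
  - by rewrite word_perm_cons er simple_transp_mulK.
have {}near : j = i.+1 :> nat by lia.
have wij : (w (lo i) < w (hi j))%N = false.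
  by move: wi wj; rewrite /ascent (hi_lo near); lia.
have uj : ~~ ascent u j by rewrite eu ascent_next // wij.
have vi : ~~ ascent v i by rewrite ev ascent_prev // wij.
have uji : ~~ ascent (s_ j * u)%g i.
  rewrite ascent_prev // eu !permM simple_transp_lo.
  have -> : s_ i (hi j) = hi j.
    apply: val_inj; rewrite /= simple_transpE /swap_nat /=.
    by do ?case: eqP => //=; lia.
  by rewrite (hi_lo near); exact: wj.
have vij : ~~ ascent (s_ i * v)%g j.
  rewrite ascent_next // ev !permM simple_transp_hi.
  have -> : s_ j (lo i) = lo i.
    apply: val_inj; rewrite /= simple_transpE /swap_nat /=.
    by do ?case: eqP => //=; lia.
  by rewrite -(hi_lo near); exact: wi.
have [r er sr] := word_exists (s_ i * (s_ j * u))%g.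
have er' : word_perm r = (s_ j * (s_ i * v))%g.
  rewrite er ev eu; have := simple_transp_braid near.
  by move=> /(congr1 (fun x => x * w)%g); rewrite -!mulgA.
have iu := inv_simple_transpN uj; have iu' := inv_simple_transpN uji.
have iv := inv_simple_transpN vi; have iv' := inv_simple_transpN vij.
rewrite (IH a [:: j, i & r]) ?(IH b [:: i, j & r]) //.
- by rewrite !word_T_cons !mulrA (hT_braid q near).
- by rewrite -sab.
- by rewrite !word_perm_cons er' !simple_transp_mulK /= sr iv iv' -er' er.
- by rewrite !word_perm_cons er' !simple_transp_mulK.
- by rewrite !word_perm_cons er !simple_transp_mulK /= sr iu iu'.
- by rewrite !word_perm_cons er !simple_transp_mulK.
Qed.

Lemma hTw_word (r : seq 'I_n.-1) :
  size r = inv (word_perm r) -> Tw (word_perm r) = word_T r.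
Proof.
move=> sr; rewrite /hTw.
have : reduced_words (word_perm r) r by apply/reduced_wordsP.
move=> /(@xgetI _ [::]) /(@reduced_wordsP n) [e s].
by apply: matsumoto; rewrite ?e.
Qed.

Lemma hTw_word_exists w :
  exists r, [/\ word_perm r = w, size r = inv w & Tw w = word_T r].
Proof.
by have [r <- sr] := word_exists w; exists r; split=> //; apply: hTw_word.
Qed.

Lemma hTw1 : Tw (1%g : 'S_n) = 1.
Proof.
have := @hTw_word ([::] : seq 'I_n.-1).
by rewrite /word_perm big_nil inv1 /word_T big_nil; apply.
Qed.

Lemma hTw_ascent w i : ascent w i -> Tw (s_ i * w)%g = T i * Tw w.
Proof.
move=> wi; have [r [er sr ->]] := hTw_word_exists w.
rewrite -er -word_perm_cons hTw_word ?word_T_cons // word_perm_cons er /= sr.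
by rewrite inv_simple_transp.
Qed.

Lemma hTw_descent w i : ~~ ascent w i -> Tw w = T i * Tw (s_ i * w)%g.
Proof.
by move=> wi; rewrite -hTw_ascent ?ascent_simple_transp // simple_transp_mulK.
Qed.

Lemma hT_sqr i : T i * T i = (q - 1) *: T i + q *: (1 : H).
Proof.
have := hT_quad q i.
rewrite mulrDl !mulrBr !mul1r -hecke_scalerAr mulr1 addrA => h.
apply/eqP; rewrite -subr_eq0 scalerBl scale1r; apply/eqP.
by rewrite -[RHS]h !opprD opprK !addrA.
Qed.

Lemma hT_mul_hTw i w : T i * Tw w =
  if ascent w i then Tw (s_ i * w)%g
  else q *: Tw (s_ i * w)%g + (q - 1) *: Tw w.
Proof.
case: ifP => [/hTw_ascent -> // | /negbT wi].
rewrite (hTw_descent wi) mulrA hT_sqr mulrDl -!hecke_scalerAl mul1r addrC.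
by rewrite -hTw_descent.
Qed.

Definition submodule (P : H -> Prop) : Prop :=
  [/\ P 0, forall x y, P x -> P y -> P (x + y) & forall c x, P x -> P (c *: x)].

Lemma submodule_sum (P : H -> Prop) (I : Type) (r : seq I) (p : pred I)
    (F : I -> H) : submodule P ->
  (forall k, p k -> P (F k)) -> P (\sum_(k <- r | p k) F k).
Proof. by case=> P0 PD _ PF; apply: big_ind. Qed.

Lemma submoduleN (P : H -> Prop) x : submodule P -> P x -> P (- x).
Proof. by case=> _ _ PZ Px; rewrite -scaleN1r; apply: PZ. Qed.

Lemma submoduleB (P : H -> Prop) x y :
  submodule P -> P x -> P y -> P (x - y).
Proof.
by move=> hP Px Py; case: (hP) => _ PD _; apply: PD => //; apply: submoduleN.
Qed.

Lemma submodule_comp (P : H -> Prop) (f : H -> H) :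
  f 0 = 0 -> {morph f : x y / x + y} -> (forall c, {morph f : x / c *: x}) ->
  submodule P -> submodule (fun x => P (f x)).
Proof.
move=> f0 fD fZ [P0 PD PZ]; split; first by rewrite f0.
  by move=> x y Px Py; rewrite fD; apply: PD.
by move=> c x Px; rewrite fZ; apply: PZ.
Qed.

Lemma submodule_mull (P : H -> Prop) h :
  submodule P -> submodule (fun x => P (h * x)).
Proof.
apply: submodule_comp; first by rewrite mulr0.
  by move=> x y; rewrite mulrDr.
by move=> c x; rewrite hecke_scalerAr.
Qed.

Lemma submodule_mulr (P : H -> Prop) h :
  submodule P -> submodule (fun x => P (x * h)).
Proof.
apply: submodule_comp; first by rewrite mul0r.
  by move=> x y; rewrite mulrDl.
by move=> c x; rewrite hecke_scalerAl.
Qed.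

Lemma hstar0 : hstar (0 : H) = 0.
Proof. by have := hstarZ 0 (0 : H); rewrite !scale0r. Qed.

Lemma submodule_hstar (P : H -> Prop) :
  submodule P -> submodule (fun x => P (hstar x)).
Proof.
apply: submodule_comp; first exact: hstar0.
  exact: hstarD.
exact: hstarZ.
Qed.

Lemma hTw_span (h : H) : exists c : 'S_n -> R, h = \sum_w c w *: Tw w.
Proof.
pose S (x : H) := exists c : 'S_n -> R, x = \sum_w c w *: Tw w.
have S_sub : submodule S.
  split.
  - by exists (fun=> 0); rewrite big1 // => w _; rewrite scale0r.
  - move=> _ _ [c ->] [d ->]; exists (fun w => c w + d w).
    by rewrite -big_split; apply: eq_bigr => w _; rewrite scalerDl.
  - move=> a _ [c ->]; exists (fun w => a * c w).
    by rewrite scaler_sumr; apply: eq_bigr => w _; rewrite scalerA.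
have S_Tw w : S (Tw w).
  exists (fun v => (v == w)%:R); rewrite (bigD1 w) //= eqxx scale1r big1 ?addr0 //.
  by move=> v /negPf ->; rewrite scale0r.
suff Sl x : S x -> S (h * x) by have := Sl 1; rewrite mulr1; apply;
  rewrite -hTw1; exact: S_Tw.
case: (S_sub) => S0 SD SZ.
elim/(@hecke_ind R q n): h x => h.
elim: h => [i | c | y IHy z IHz | y IHy z IHz] x.
- move=> [c ->]; rewrite mulr_sumr; apply: submodule_sum => // w _.
  rewrite -hecke_scalerAr; apply: (SZ); rewrite [_ * _]hT_mul_hTw.
  by case: ifP => _; [apply: S_Tw | apply: SD; apply: (SZ); apply: S_Tw].
- exact: SZ.
- by move=> Sx; rewrite hpiD mulrDl; apply: SD; [apply: IHy | apply: IHz].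
- by move=> Sx; rewrite hpiM -mulrA; apply: IHy; apply: IHz.
Qed.

Lemma hTw_ind (P : H -> Prop) :
  submodule P -> (forall w, P (Tw w)) -> forall h, P h.
Proof.
move=> hP PT h; have [c ->] := hTw_span h.
by apply: submodule_sum => // w _; case: (hP) => _ _ PZ; apply: PZ.
Qed.

Lemma hstar1 : hstar (1 : H) = 1.
Proof. exact: hstar_scal. Qed.

Lemma hstar_sum (I : Type) (r : seq I) (p : pred I) (F : I -> H) :
  hstar (\sum_(k <- r | p k) F k) = \sum_(k <- r | p k) hstar (F k).
Proof. by apply: (big_morph (@hstar R q n) (@hstarD R q n) hstar0). Qed.

Lemma hstar_hTw w : hstar (Tw w) = Tw w^-1.
Proof.
have [r [<- sr ->]] := hTw_word_exists w.
rewrite -word_perm_rev hTw_word; last first.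
  by rewrite word_perm_rev invV size_rev sr.
elim: r {sr} => [|i r IH]; first by rewrite /word_T big_nil hstar1.
rewrite word_T_cons hstarM IH hstarT rev_cons -cats1 /word_T big_cat /=.
by rewrite big_seq1.
Qed.

Fixpoint regular (x : hterm R n) (f : 'S_n -> R) : 'S_n -> R :=
  match x with
  | HGen i => fun w =>
      if ascent w i then q * f (s_ i * w)%g
      else f (s_ i * w)%g + (q - 1) * f w
  | HScal c => fun w => c * f w
  | HAdd x y => fun w => regular x f w + regular y f w
  | HMul x y => regular x (regular y f)
  end.

Lemma regular_linear x (a : R) (f g : 'S_n -> R) :
  regular x (fun w => a * f w + g w) =
  fun w => a * regular x f w + regular x g w.
Proof.
elim: x f g => [i | c | y IHy z IHz | y IHy z IHz] f g /=.
- by apply: funext => w; case: ifP => _; ring.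
- by apply: funext => w; ring.
- by rewrite IHy IHz; apply: funext => w; ring.
- by rewrite IHz IHy.
Qed.

Lemma regularD x (f g : 'S_n -> R) :
  regular x (fun w => f w + g w) = fun w => regular x f w + regular x g w.
Proof.
have := regular_linear x 1 f g.
have -> : (fun w => 1 * f w + g w) = (fun w => f w + g w).
  by apply: funext => w; rewrite mul1r.
by move=> ->; apply: funext => w; rewrite mul1r.
Qed.

Lemma regularZ x (a : R) (f : 'S_n -> R) :
  regular x (fun w => a * f w) = fun w => a * regular x f w.
Proof.
have r0 : regular x (fun=> 0) = fun=> 0.
  have := regular_linear x (-1) (fun=> 0) (fun=> 0).
  have -> : (fun w : 'S_n => -1 * 0 + 0) = (fun=> 0 : R).
    by apply: funext => w; ring.
  by move=> e; rewrite e; apply: funext => w; ring.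
have := regular_linear x a f (fun=> 0).
have -> : (fun w => a * f w + 0) = (fun w => a * f w).
  by apply: funext => w; rewrite addr0.
by move=> ->; rewrite r0; apply: funext => w; rewrite addr0.
Qed.

Lemma regular_comm i j (f : 'S_n -> R) : (i.+1 < j)%N ->
  regular (HMul (HGen i) (HGen j)) f = regular (HMul (HGen j) (HGen i)) f.
Proof.
move=> ij; apply: funext => w /=.
rewrite !ascent_far ?ij ?orbT // !mulgA (simple_transp_comm ij).
by case: (ascent w i); case: (ascent w j); ring.
Qed.

Lemma regular_braid i j (f : 'S_n -> R) : j = i.+1 :> nat ->
  regular (HMul (HMul (HGen i) (HGen j)) (HGen i)) f =
  regular (HMul (HMul (HGen j) (HGen i)) (HGen j)) f.
Proof.
move=> ij; apply: funext => w /=.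
rewrite !ascent_simple_transp !simple_transp_mulK.
have e1 : ascent (s_ j * (s_ i * w)) i = ascent w j.
  rewrite ascent_prev // !permM simple_transp_lo /ascent (hi_lo ij).
  congr (_ < w _)%N; apply: val_inj; rewrite /= simple_transpE /swap_nat /=.
  by do ?case: eqP => //=; lia.
have e2 : ascent (s_ i * (s_ j * w)) j = ascent w i.
  rewrite ascent_next // !permM simple_transp_hi /ascent (hi_lo ij).
  congr (w _ < _)%N; apply: val_inj; rewrite /= simple_transpE /swap_nat /=.
  by do ?case: eqP => //=; lia.
rewrite e1 e2 (ascent_next w ij) (ascent_prev w ij).
have := simple_transp_braid ij.
move=> /(congr1 (fun x => x * w)%g); rewrite -!mulgA => ->.
have : (ascent w i && ascent w j ==> (w (lo i) < w (hi j))%N) &&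
       (~~ ascent w i && ~~ ascent w j ==> (w (hi j) < w (lo i))%N).
  have : w (lo i) <> w (hi j) :> nat by apply: perm_val_neq => /=; lia.
  by rewrite /ascent (hi_lo ij); lia.
case: (ascent w i); case: (ascent w j) => /=;
  case: ltngtP => //= *; ring.
Qed.

Lemma regular_cong x y : hcong q x y -> regular x = regular y.
Proof.
elim=> {x y} //=.
- by move=> ? ? ? _ -> _ ->.
- by move=> ? ? ? ? _ -> _ ->.
- by move=> ? ? ? ? _ -> _ ->.
- by move=> *; apply: funext => f; apply: funext => w; ring.
- by move=> *; apply: funext => f; apply: funext => w; ring.
- by move=> *; apply: funext => f; apply: funext => w; ring.
- by move=> *; apply: funext => f; apply: funext => w; ring.
- by move=> *; apply: funext => f; apply: funext => w; ring.
- by move=> x y z; apply: funext => f; rewrite regularD.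
- by move=> *; apply: funext => f; apply: funext => w; ring.
- by move=> *; apply: funext => f; apply: funext => w; ring.
- by move=> a x; apply: funext => f; rewrite regularZ.
- by move=> i j ij; apply: funext => f; apply: (regular_comm f ij).
- by move=> i j ij; apply: funext => f; apply: (regular_braid f ij).
move=> i; apply: funext => f; apply: funext => w.
rewrite ascent_simple_transp simple_transp_mulK.
by case: (ascent w i) => /=; ring.
Qed.

Definition coef w (h : H) : R := regular (generic_quotient.repr h) (fun v => (v == 1%g)%:R) w.

Lemma coef_hpi w (x : hterm R n) :
  coef w (hpi q x) = regular x (fun v => (v == 1%g)%:R) w.
Proof. by rewrite /coef (regular_cong (hcong_repr q x)). Qed.

Lemma coefD w : {morph coef w : x y / x + y}.
Proof.
elim/(@hecke_ind R q n) => x; elim/(@hecke_ind R q n) => y.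
by rewrite -hpiD !coef_hpi.
Qed.

Lemma coefZ w (c : R) (h : H) : coef w (c *: h) = c * coef w h.
Proof.
elim/(@hecke_ind R q n): h => x.
by rewrite [c *: _](_ : _ = hpi q (HMul (HScal c) x)) ?coef_hpi // hpiM.
Qed.

Lemma coef0 w : coef w 0 = 0.
Proof. by rewrite -(scale0r (0 : H)) coefZ mul0r. Qed.

Lemma coef_sum w (I : Type) (r : seq I) (p : pred I) (F : I -> H) :
  coef w (\sum_(k <- r | p k) F k) = \sum_(k <- r | p k) coef w (F k).
Proof. by apply: (big_morph (coef w) (coefD w) (coef0 w)). Qed.

Lemma coef_hTw w v : coef w (Tw v) = (w == v)%:R.
Proof.
elim/(@perm_ind_left n): v w => [|v i vi IH] w.
  by rewrite hTw1 [LHS]coef_hpi /= mul1r.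
rewrite hTw_ascent //.
have -> : coef w (T i * Tw v) = if ascent w i then q * coef (s_ i * w)%g (Tw v)
    else coef (s_ i * w)%g (Tw v) + (q - 1) * coef w (Tw v).
  elim/(@hecke_ind R q n): (Tw v) => x.
  by rewrite -hpiM !coef_hpi.
rewrite !IH; have -> : (s_ i * w == v)%g = (w == s_ i * v)%g.
  by rewrite -{1}(simple_transp_mulK i v); apply/eqP/eqP => [/mulgI | -> //].
case: ifP => wi.
  have -> : (w == s_ i * v)%g = false; last by rewrite mulr0.
  by apply/eqP => e; move: wi; rewrite e ascent_simple_transp vi.
have -> : (w == v) = false; last by rewrite mulr0 addr0.
by apply/eqP => e; move: wi; rewrite e vi.
Qed.

Lemma hT_right_inverse (q' : R) i : q * q' = 1 ->
  T i * (q' *: (T i - (q - 1) *: (1 : H))) = 1.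
Proof.
move=> qq'; rewrite -hecke_scalerAr mulrBr hT_sqr -hecke_scalerAr mulr1.
by rewrite addrAC subrr add0r scalerA mulrC qq' scale1r.
Qed.

Lemma hTw_right_inverse (q' : R) w : q * q' = 1 -> exists h, Tw w * h = 1.
Proof.
move=> qq'; elim/(@perm_ind_left n): w => [|w i wi [h hh]].
  by exists 1; rewrite hTw1 mulr1.
exists (h * (q' *: (T i - (q - 1) *: (1 : H)))).
by rewrite hTw_ascent // mulrA -(mulrA _ _ h) hh mulr1 hT_right_inverse.
Qed.

End HeckeBasis.

(** * Parabolic subgroups *)

Definition monotone (b : nat -> nat) : Prop := {homo b : i j / (i <= j)%N}.

Section Parabolic.
Context {n : nat}.
Implicit Types (u v w d : 'S_n) (i j : 'I_n.-1) (b : nat -> nat).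
Local Notation s_ i := (simple_transp i).

Definition parab b : {set 'S_n} := [set w : 'S_n | [forall k, b (w k) == b k]].

Definition incr b w : bool :=
  [forall k : 'I_n, forall l : 'I_n, (k < l)%N && (b k == b l) ==> (w k < w l)%N].

Lemma parabP b w : reflect (forall k, b (w k) = b k) (w \in parab b).
Proof.
by rewrite inE; apply: (iffP forallP) => h k; have := h k => /eqP.
Qed.

Lemma incrP b w :
  reflect (forall k l : 'I_n, (k < l)%N -> b k = b l -> (w k < w l)%N) (incr b w).
Proof.
apply: (iffP forallP) => [h k l kl bkl | h k].
  by have /forallP/(_ l) := h k; rewrite kl bkl eqxx.
by apply/forallP => l; apply/implyP => /andP [kl /eqP]; apply: h.
Qed.

Lemma parab1 b : 1%g \in parab b.
Proof. by apply/parabP => k; rewrite perm1. Qed.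

Lemma parabM b u w : u \in parab b -> w \in parab b -> (u * w)%g \in parab b.
Proof. by move=> /parabP hu /parabP hw; apply/parabP => k; rewrite permM hw. Qed.

Lemma parabV b w : w \in parab b -> (w^-1)%g \in parab b.
Proof.
by move=> /parabP hw; apply/parabP => k; rewrite -{2}(permKV w k) hw.
Qed.

Lemma parab_simple_transp b i : b i = b i.+1 -> s_ i \in parab b.
Proof.
move=> bi; apply/parabP => k; rewrite simple_transpE /swap_nat.
by case: eqP => [->|_] //; case: eqP => [->|_].
Qed.

Lemma incr_ascent b w i : incr b w -> b i = b i.+1 -> ascent w i.
Proof. by move=> /incrP h bi; apply: h. Qed.

Lemma incr_of_ascents b w : monotone b ->
  (forall i, b i = b i.+1 -> ascent w i) -> incr b w.
Proof.
move=> mb asc; apply/incrP => k l.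
move: {2}(l - k)%N (erefl (l - k)%N) => e; elim: e l => [|e IH] l el kl bkl.
  by lia.
have hl : (l.-1.+1 < n)%N by have := ltn_ord l; lia.
have [i il] := gen_exists hl.
have hil : hi i = l by apply: val_inj => /=; lia.
have b1 := mb k (lo i) _; have b2 := mb (lo i) l _.
have bi : b i = b l by move: b1 b2; rewrite /= => b1 b2; lia.
have := asc i; rewrite /ascent hil bi => /(_ _)/wrap[].
  by congr b; lia.
have [ki | ki] := eqVneq k (lo i); first by rewrite ki.
have := IH (lo i); rewrite /= bi bkl => h1 h2.
have ki' : (k < i)%N by move: ki; rewrite -val_eqE /=; lia.
by have := h1 _ ki' erefl; lia.
Qed.

Lemma incrN_descent b w : monotone b -> ~~ incr b w ->
  exists2 i : 'I_n.-1, b i = b i.+1 & ~~ ascent w i.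
Proof.
move=> mb /negP nw; apply: contrapT => h; apply: nw; apply: incr_of_ascents => //.
move=> i bi; apply: contrapT => /negP ni; apply: h; by exists i.
Qed.

Lemma parab_ascent b w i : monotone b -> w \in parab b -> b i <> b i.+1 ->
  ascent w i.
Proof.
move=> mb /parabP hw bi; apply: contrapT => /negP/ascentN lt.
apply: bi; apply/eqP; rewrite eqn_leq mb //=.
by have := hw (lo i); have := hw (hi i); rewrite /= => <- <-; apply/mb/ltnW.
Qed.

Lemma parab_incr b w : monotone b -> w \in parab b -> incr b w -> w = 1%g.
Proof.
move=> mb hw iw; apply: all_ascents => i.
case: (eqVneq (b i) (b i.+1)) => [|/eqP]; first exact: incr_ascent.
exact: parab_ascent.
Qed.

Lemma parab_ind b (P : 'S_n -> Prop) (mb : monotone b) : P 1%g ->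
  (forall w i, w \in parab b -> b i = b i.+1 -> ascent w i -> P w ->
    P (s_ i * w)%g) ->
  forall w, w \in parab b -> P w.
Proof.
move=> P1 PS w; move: {2}(inv w) (erefl (inv w)) => k.
elim: k w => [|k IH] w e hw; first by rewrite (inv_eq0 e).
case: (boolP (incr b w)) => [iw | /(incrN_descent mb) [i bi wi]].
  by rewrite (parab_incr mb hw iw).
rewrite -(simple_transp_mulK i w).
have hsw : (s_ i * w)%g \in parab b by apply: parabM; rewrite ?parab_simple_transp.
apply: PS => //; first by rewrite ascent_simple_transp.
by apply: IH => //; have := inv_simple_transpN wi; lia.
Qed.

Lemma incr_parab_uniq b u u' d d' : monotone b ->
  u \in parab b -> u' \in parab b -> incr b d -> incr b d' ->
  (u * d = u' * d')%g -> u = u' /\ d = d'.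
Proof.
move=> mb hu hu' id id' e.
suff : (u'^-1 * u)%g = 1%g.
  move=> h; have eu : u = u' by rewrite -(mulKVg u' u) h mulg1.
  by split=> //; move: e; rewrite eu => /mulgI.
have hv : (u'^-1 * u)%g \in parab b by apply: parabM => //; apply: parabV.
have ed : d' = (u'^-1 * u * d)%g by rewrite -mulgA e mulKg.
apply: (parab_incr mb hv); apply/incrP => k l kl bkl.
move/incrP: id' => /(_ k l kl bkl); rewrite ed !(permM _ d).
move/parabP: hv => hv; set x := (u'^-1 * u)%g in hv *.
move/incrP: id => /(_ (x l) (x k)); rewrite !hv => h1 h2.
have : x k <> x l :> nat by apply: perm_val_neq; lia.
have [] := ltnP (x l) (x k); last by lia.
by move=> /h1 /(_ (esym bkl)); lia.
Qed.

Lemma parab_decomp b w : monotone b -> exists u d,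
  [/\ u \in parab b, incr b d, w = (u * d)%g & inv w = (inv u + inv d)%N].
Proof.
move=> mb; move: {2}(inv w) (erefl (inv w)) => k.
elim: k w => [|k IH] w e; (case: (boolP (incr b w)) =>
    [iw | /(incrN_descent mb) [i bi wi]];
  first by exists 1%g, w; rewrite parab1 mul1g inv1).
  by have := inv_simple_transpN wi; rewrite e.
have [|u [d [hu hd ew iw]]] := IH (s_ i * w)%g.
  by have := inv_simple_transpN wi; rewrite e => -[].
exists (s_ i * u)%g, d; split=> //.
- by apply: parabM => //; apply: parab_simple_transp.
- by rewrite -mulgA -ew simple_transp_mulK.
have ui : ascent u i.
  move: wi; rewrite -ascent_simple_transp ew /ascent !permM.
  move/parabP: hu => hu; move/incrP: hd => /(_ (u (hi i)) (u (lo i))).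
  rewrite !hu /= => h.
  have : u (lo i) <> u (hi i) :> nat by apply: perm_val_neq => /=; lia.
  have [|] := ltnP (u (hi i)) (u (lo i)); last by lia.
  by move=> /h/(_ (esym bi)); lia.
by rewrite inv_simple_transp // (inv_simple_transpN wi) iw.
Qed.

Lemma inv_parab_mul b u d : monotone b -> u \in parab b -> incr b d ->
  inv (u * d) = (inv u + inv d)%N.
Proof.
move=> mb hu hd; have [u' [d' [hu' hd' e ->]]] := parab_decomp (u * d)%g mb.
by have [-> ->] := incr_parab_uniq mb hu hu' hd hd' e.
Qed.

Lemma inv_parab_mulr b d u : monotone b -> u \in parab b -> incr b d^-1 ->
  inv (d * u) = (inv d + inv u)%N.
Proof.
move=> mb hu hd; rewrite -invV invMg (inv_parab_mul mb) ?parabV //.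
by rewrite !invV addnC.
Qed.

Definition refines (b b' : nat -> nat) : Prop :=
  forall k l : 'I_n, b k = b l -> b' k = b' l.

Lemma refines_parab b b' w : refines b b' -> w \in parab b -> w \in parab b'.
Proof. by move=> r /parabP hw; apply/parabP => k; apply/r/hw. Qed.

Definition min_reps b b' : {set 'S_n} :=
  [set d : 'S_n | (d \in parab b') && incr b d].

Lemma parab_factor b b' : monotone b -> refines b b' ->
  parab b' = ((fun p => p.1 * p.2)%g @: finset.setX (parab b) (min_reps b b'))%SET.
Proof.
move=> mb r; apply/setP => w; apply/idP/imsetP.
  move=> hw; have [u [d [hu hd e _]]] := parab_decomp w mb.
  exists (u, d) => //; rewrite finset.in_setX hu inE hd andbT /=.
  have -> : d = (u^-1 * w)%g by rewrite e mulKg.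
  by apply: parabM => //; apply/parabV/(refines_parab r).
case=> -[u d]; rewrite finset.in_setX /= => /andP [hu].
rewrite inE => /andP [hd _] ->.
by apply: parabM => //; apply: refines_parab hu.
Qed.

End Parabolic.

Section ParabolicSum.
Context {R : comPzRingType} (q : R) {n : nat}.
Implicit Types (u v w d : 'S_n) (i j : 'I_n.-1) (b : nat -> nat).
Local Notation H := (hecke q n).
Local Notation s_ i := (simple_transp i).
Local Notation T i := (hT q i).
Local Notation Tw w := (hTw q w).

Lemma hTw_additive u v : inv (u * v) = (inv u + inv v)%N ->
  Tw (u * v)%g = Tw u * Tw v.
Proof.
have [r [<- sr ->]] := hTw_word_exists q u.
have [r' [<- sr' ->]] := hTw_word_exists q v => e.
rewrite -word_perm_cat hTw_word; first by rewrite /word_T big_cat.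
by rewrite word_perm_cat e size_cat sr sr'.
Qed.

Lemma hTw_mul_ind (P : H -> Prop) u v : submodule P ->
  (forall w, (inv w < inv u + inv v)%N -> P (Tw w)) ->
  (inv (u * v) = (inv u + inv v)%N -> P (Tw (u * v)%g)) -> P (Tw u * Tw v).
Proof.
elim/(@perm_ind_left n): u P => [|u i ui IH] P hP Plt Peq.
  by rewrite hTw1 mul1r; move: Peq; rewrite mul1g inv1; apply.
rewrite inv_simple_transp // in Plt Peq; rewrite hTw_ascent // -mulrA.
apply: (IH (fun h => P (T i * h))); first exact: submodule_mull.
  move=> w lt; rewrite hT_mul_hTw; case: ifP => wi.
    by apply: Plt; rewrite inv_simple_transp //; lia.
  case: (hP) => _ PD PZ; have := inv_simple_transpN (negbT wi) => e.
  by apply: PD; apply: PZ; apply: Plt; lia.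
move=> e; rewrite hT_mul_hTw mulgA; case: ifP => uvi.
  by apply: Peq; rewrite -mulgA inv_simple_transp // e.
case: (hP) => _ PD PZ; have := inv_simple_transpN (negbT uvi).
by rewrite mulgA => e'; apply: PD; apply: PZ; apply: Plt; lia.
Qed.

Definition parab_sum (c : R) b : H := \sum_(u in parab b) c ^+ inv u *: Tw u.

Lemma hstar_parab_sum c b : hstar (parab_sum c b) = parab_sum c b.
Proof.
rewrite hstar_sum [RHS](reindex_inj invg_inj) /=.
apply: eq_big => u; last by rewrite hstarZ hstar_hTw invV.
by apply/idP/idP => [/parabV // | /parabV]; rewrite invgK.
Qed.

Lemma parab_sum_factorl c b i : b i = b i.+1 ->
  exists h, parab_sum c b = (1 + c *: T i) * h.
Proof.
move=> bi; exists (\sum_(u in parab b | ascent u i) c ^+ inv u *: Tw u).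
rewrite /parab_sum (bigID (fun u => ascent u i)) /= mulrDl mul1r.
congr (_ + _); rewrite mulr_sumr (reindex_inj (mulgI (s_ i))) /=.
apply: eq_big => u.
  rewrite ascent_simple_transp negbK; congr (_ && _).
  apply/idP/idP => hu; last by rewrite parabM ?parab_simple_transp.
  by rewrite -(simple_transp_mulK i u) parabM ?parab_simple_transp.
rewrite ascent_simple_transp negbK => /andP [_ ui].
rewrite inv_simple_transp // hTw_ascent // exprS -scalerA.
by rewrite -hecke_scalerAl -!hecke_scalerAr.
Qed.

Lemma parab_sum_factorr c b i : b i = b i.+1 ->
  exists h, parab_sum c b = h * (1 + c *: T i).
Proof.
move=> /(parab_sum_factorl c) [h e]; exists (hstar h).
by rewrite -hstar_parab_sum e hstarM hstarD hstar1 hstarZ hstarT.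
Qed.

Lemma T_mul_parab_sum1 b i : b i = b i.+1 ->
  T i * parab_sum 1 b = q *: parab_sum 1 b.
Proof.
move=> /(parab_sum_factorl 1) [h ->]; rewrite scale1r mulrA hecke_scalerAl.
congr (_ * _); rewrite mulrDr mulr1 hT_sqr addrA -[X in X + _ + _]scale1r.
by rewrite -scalerDl scalerDr addrCA subrr addr0 addrC.
Qed.

Lemma parab_sum1_mul_T b i : b i = b i.+1 ->
  parab_sum 1 b * T i = q *: parab_sum 1 b.
Proof.
move=> bi; apply: (can_inj (@hstarK R q n)).
by rewrite hstarM hstarZ hstar_parab_sum hstarT T_mul_parab_sum1.
Qed.

Lemma T_mul_factorN q' i : q * q' = 1 ->
  T i * (1 + (- q') *: T i) = - (1 + (- q') *: T i).
Proof.
move=> qq'; rewrite mulrDr mulr1 -hecke_scalerAr hT_sqr scalerDr !scalerA.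
have -> : - q' * q = -1 by rewrite mulNr mulrC qq'.
have -> : - q' * (q - 1) = - 1 + q' by rewrite mulrBr mulr1 mulNr mulrC qq' opprK.
have aux (V : lmodType R) (x z : V) :
    x + ((-1 + q') *: x + (-1) *: z) = - (z + (- q') *: x).
  by rewrite scalerDl !scaleN1r !addrA subrr add0r opprD scaleNr opprK addrC.
exact: aux.
Qed.

Lemma T_mul_parab_sumN q' b i : q * q' = 1 -> b i = b i.+1 ->
  T i * parab_sum (- q') b = - parab_sum (- q') b.
Proof.
move=> qq' /(parab_sum_factorl (- q')) [h ->].
by rewrite mulrA T_mul_factorN // mulNr.
Qed.

(* The eigenvalues q and -1 of T_i would only give (q + 1) m T_w y = 0, which is
   useless when q + 1 is a zero divisor; the factors 1 + T_i of m and 1 - T_j / q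
   of y kill the product outright. *)
Lemma T_braid_zero q' i j w : q * q' = 1 -> (s_ i * w = w * s_ j)%g ->
  ascent w i -> ascent w^-1 j ->
  (1 + T i) * Tw w * (1 + (- q') *: T j) = 0.
Proof.
move=> qq' e wi wj.
have e2 : T i * Tw w = Tw w * T j.
  rewrite -hTw_ascent // e; apply: (can_inj (@hstarK R q n)).
  rewrite hstarM hstarT !hstar_hTw invMg simple_transpV.
  by rewrite hTw_ascent.
rewrite mulrDl mul1r e2 -{1}(mulr1 (Tw w)) -mulrDr -mulrA.
by rewrite mulrDl mul1r T_mul_factorN // addrN mulr0.
Qed.

Lemma parab_sum1_mul_hTw b u : monotone b -> u \in parab b ->
  parab_sum 1 b * Tw u = q ^+ inv u *: parab_sum 1 b.
Proof.
move=> mb; move: u; apply: parab_ind => //.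
  by rewrite hTw1 mulr1 inv1 scale1r.
move=> u i hu bi ui e; rewrite hTw_ascent // mulrA parab_sum1_mul_T //.
by rewrite -hecke_scalerAl e scalerA inv_simple_transp // exprS.
Qed.

Lemma parab_sum_factor b b' : monotone b -> refines (n := n) b b' ->
  parab_sum 1 b' =
  parab_sum 1 b * \sum_(d in min_reps b b') Tw d.
Proof.
move=> mb r; rewrite /parab_sum (parab_factor mb r) big_imset /=; last first.
  move=> [u d] [u' d']; rewrite !finset.in_setX /=.
  move=> /andP [hu hd] /andP [hu' hd'] e; rewrite inE in hd; rewrite inE in hd'.
  case/andP: hd hd' => _ hd /andP [_ hd'].
  by have [-> ->] := incr_parab_uniq mb hu hu' hd hd' e.
rewrite mulr_suml; under [RHS]eq_bigr do rewrite mulr_sumr.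
rewrite pair_big /=; apply: eq_big => -[u d]; rewrite finset.in_setX //=.
case/andP=> hu; rewrite inE => /andP [_ hd].
by rewrite !expr1n !scale1r hTw_additive // (inv_parab_mul mb).
Qed.

End ParabolicSum.

(** * Tableaux as permutations *)

Fixpoint row_of (mu : seq nat) (k : nat) : nat :=
  if mu is a :: mu' then if (k < a)%N then 0%N else (row_of mu' (k - a)).+1
  else 0%N.

Fixpoint col_of (mu : seq nat) (k : nat) : nat :=
  if mu is a :: mu' then if (k < a)%N then k else col_of mu' (k - a) else 0%N.

Section RowsColumns.
Implicit Types (mu : seq nat) (k l r c : nat).

Lemma monotone_row_of mu : monotone (row_of mu).
Proof.
elim: mu => [//|a mu IH] k l kl /=; case: (ltnP k a) => // ak; case: (ltnP l a) => [|al].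
  by lia.
by rewrite ltnS; apply: IH; lia.
Qed.

Lemma row_of_cat mu nu k : row_of (mu ++ nu) k =
  if (k < sumn mu)%N then row_of mu k
  else (size mu + row_of nu (k - sumn mu))%N.
Proof.
elim: mu k => [|a mu IH] k /=; first by rewrite subn0.
rewrite IH; case: (ltnP k a) => ka; first by rewrite ltn_addr.
have -> : (k - a < sumn mu)%N = (k < a + sumn mu)%N by lia.
by case: ifP => _ //; rewrite addSn subnDA.
Qed.

Lemma row_of_size mu k : (k < sumn mu)%N -> (row_of mu k < size mu)%N.
Proof.
by elim: mu k => [//|a mu IH] k /= h; case: (ltnP k a) => // ak; apply: IH; lia.
Qed.

Lemma row_colK mu k : (k < sumn mu)%N ->
  (sumn (take (row_of mu k) mu) + col_of mu k)%N = k.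
Proof.
elim: mu k => [//|a mu IH] k /= h; case: (ltnP k a) => // ak /=.
by rewrite -addnA IH; lia.
Qed.

Lemma col_of_lt mu k : (k < sumn mu)%N ->
  (col_of mu k < nth 0 mu (row_of mu k))%N.
Proof.
by elim: mu k => [//|a mu IH] k /= h; case: (ltnP k a) => // ak; apply: IH; lia.
Qed.

Lemma pos_lt mu r c : (c < nth 0 mu r)%N -> (sumn (take r mu) + c < sumn mu)%N.
Proof.
elim: mu r => [|a mu IH] [|r] //=; first by lia.
by move=> /IH; lia.
Qed.

Lemma row_of_pos mu r c : (c < nth 0 mu r)%N ->
  row_of mu (sumn (take r mu) + c) = r.
Proof.
elim: mu r => [|a mu IH] [|r] //= h; first by rewrite add0n h.
by rewrite ltnNge -addnA leq_addr addKn IH.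
Qed.

Lemma col_of_pos mu r c : (c < nth 0 mu r)%N ->
  col_of mu (sumn (take r mu) + c) = c.
Proof.
elim: mu r => [|a mu IH] [|r] //= h; first by rewrite add0n h.
by rewrite ltnNge -addnA leq_addr addKn IH.
Qed.

Lemma same_row mu k l : (k < sumn mu)%N -> (l < sumn mu)%N ->
  row_of mu k = row_of mu l -> (k + col_of mu l = l + col_of mu k)%N.
Proof.
by move=> hk hl e; have := row_colK hk; have := row_colK hl; rewrite e; lia.
Qed.

Lemma nth_sorted_geq mu r c : sorted geq mu -> (r <= c)%N ->
  (nth 0 mu c <= nth 0 mu r)%N.
Proof.
move=> srt rc; have [hc|hc] := ltnP c (size mu); last by rewrite nth_default.
have geqT : transitive geq by move=> x y z /= h1 h2; apply: leq_trans h2 h1.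
by apply: (sorted_leq_nth geqT (@leqnn)) => //; rewrite inE; lia.
Qed.

Lemma box_exists mu r c : (c < nth 0 mu r)%N ->
  exists x : box mu, brow x = r /\ bcol x = c.
Proof.
move=> h; have hr : (r < size mu)%N.
  by case: ltnP => // /(nth_default 0%N) e; rewrite e in h.
by exists (existT (fun r : 'I_(size mu) => 'I_(nth 0%N mu r))
  (Ordinal hr) (Ordinal h)).
Qed.

Lemma bcol_lt mu (x : box mu) : (bcol x < nth 0 mu (brow x))%N.
Proof. by case: x => r c; rewrite /bcol /brow /=. Qed.

Lemma box_inj mu (x y : box mu) : brow x = brow y -> bcol x = bcol y -> x = y.
Proof.
case: x y => [r c] [r' c']; rewrite /brow /bcol /= => /val_inj e.
by subst r'; move=> /val_inj ->.
Qed.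

Lemma initial_fillingE mu (x : box mu) :
  initial_filling 0 x = (sumn (take (brow x) mu) + bcol x)%N.
Proof. by []. Qed.

Lemma initial_filling_lt mu (x : box mu) : (initial_filling 0 x < sumn mu)%N.
Proof. exact/pos_lt/bcol_lt. Qed.

Lemma row_of_initial mu (x : box mu) : row_of mu (initial_filling 0 x) = brow x.
Proof. exact/row_of_pos/bcol_lt. Qed.

Lemma col_of_initial mu (x : box mu) : col_of mu (initial_filling 0 x) = bcol x.
Proof. exact/col_of_pos/bcol_lt. Qed.

Lemma initial_filling_surj mu k : (k < sumn mu)%N ->
  exists x : box mu, initial_filling 0 x = k.
Proof.
move=> hk; have [x [hr hc]] := box_exists (col_of_lt hk).
by exists x; rewrite initial_fillingE hr hc row_colK.
Qed.

End RowsColumns.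

Section Tableaux.
Context {n : nat} (mu : seq nat) (mu_n : sumn mu = n).
Implicit Types (w : 'S_n) (k l : 'I_n).

Lemma perm_natE w k : perm_nat w k = w k.
Proof. by rewrite /perm_nat valK. Qed.

Definition initial_ord (x : box mu) : 'I_n :=
  Ordinal (eq_ind _ (fun m => initial_filling 0 x < m)%N
    (initial_filling_lt x) _ mu_n).

Lemma act_initial w (x : box mu) :
  act_filling (@initial_filling 0 mu) w x = w (initial_ord x).
Proof. exact: (perm_natE w (initial_ord x)). Qed.

Lemma initial_ord_surj k : exists x : box mu, initial_ord x = k.
Proof.
have hk : (k < sumn mu)%N by rewrite mu_n.
by have [x e] := initial_filling_surj hk; exists x; apply: val_inj.
Qed.

Lemma row_initial_ord (x : box mu) : row_of mu (initial_ord x) = brow x.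
Proof. exact: row_of_initial. Qed.

Lemma col_initial_ord (x : box mu) : col_of mu (initial_ord x) = bcol x.
Proof. exact: col_of_initial. Qed.

Lemma row_stabilizer_parab : row_stabilizer n mu = parab (row_of mu).
Proof.
apply/setP => w; rewrite inE; apply/forallP/parabP => h.
  move=> k; have [x <-] := initial_ord_surj k.
  have /existsP [y /andP [/eqP bxy /eqP]] := h x.
  by rewrite act_initial => ->; rewrite row_of_initial row_initial_ord.
move=> x; have [y e] := initial_ord_surj (w (initial_ord x)).
apply/existsP; exists y; rewrite act_initial -e eqxx andbT.
by rewrite -!row_initial_ord e h.
Qed.

Lemma row_standardE w :
  row_standard (act_filling (@initial_filling 0 mu) w) = incr (row_of mu) w.
Proof.
apply/forallP/incrP => h.
  move=> k l; have [x <-] := initial_ord_surj k.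
  have [y <-] := initial_ord_surj l; have /forallP/(_ y) := h x.
  rewrite !act_initial !row_initial_ord => /implyP hxy kl e.
  apply: hxy; rewrite e eqxx /=; move: kl.
  by rewrite /= !initial_fillingE e ltn_add2l.
move=> x; apply/forallP => y; apply/implyP => /andP [/eqP e xy].
rewrite !act_initial; apply: h; last by rewrite !row_initial_ord.
by rewrite /= !initial_fillingE e ltn_add2l.
Qed.

Definition col_incr w : bool :=
  [forall k : 'I_n, forall l : 'I_n, (col_of mu k == col_of mu l) &&
    (row_of mu k < row_of mu l)%N ==> (w k < w l)%N].

Lemma col_incrP w : reflect (forall k l, col_of mu k = col_of mu l ->
  (row_of mu k < row_of mu l)%N -> (w k < w l)%N) (col_incr w).
Proof.
apply: (iffP forallP) => [h k l e kl | h k].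
  by have /forallP/(_ l) := h k; rewrite e eqxx kl.
by apply/forallP => l; apply/implyP => /andP [/eqP]; apply: h.
Qed.

Lemma column_standardE w :
  column_standard (act_filling (@initial_filling 0 mu) w) = col_incr w.
Proof.
apply/forallP/col_incrP => h.
  move=> k l; have [x <-] := initial_ord_surj k.
  have [y <-] := initial_ord_surj l; have /forallP/(_ y) := h x.
  rewrite !act_initial !row_initial_ord !col_initial_ord => /implyP hxy e kl.
  by apply: hxy; rewrite e eqxx.
move=> x; apply/forallP => y; apply/implyP => /andP [/eqP e xy].
by rewrite !act_initial; apply: h; rewrite ?col_initial_ord ?row_initial_ord.
Qed.

Lemma tab_perm_act w : tab_perm n (act_filling (@initial_filling 0 mu) w) = w.
Proof.
rewrite /tab_perm; case: pickP => [d /forallP hd | /(_ w) /negP []]; last first.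
  exact/forallP.
apply/permP => k; have [x <-] := initial_ord_surj k; apply: val_inj => /=.
by have /eqP := hd x; rewrite !act_initial.
Qed.

Lemma act_is_tableau w :
  is_tableau n (act_filling (@initial_filling 0 mu) w).
Proof.
split.
  move=> x y; rewrite !act_initial => /val_inj/perm_inj e.
  by apply: box_inj; rewrite -?row_initial_ord -?col_initial_ord e.
move=> k; split; last by move=> [x <-]; rewrite act_initial.
move=> hk; have [x e] := initial_ord_surj ((w^-1)%g (Ordinal hk)).
by exists x; rewrite act_initial e permKV.
Qed.

Lemma Std_exists w : incr (row_of mu) w -> col_incr w ->
  exists2 t : filling mu, Std n t & tab_perm n t = w.
Proof.
move=> hr hc; exists (act_filling (@initial_filling 0 mu) w).
  by split; rewrite ?row_standardE ?column_standardE //; apply: act_is_tableau.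
exact: tab_perm_act.
Qed.

Lemma m_eltE (R : comPzRingType) (q : R) :
  m_elt q n mu = parab_sum q 1 (row_of mu).
Proof.
rewrite /m_elt row_stabilizer_parab; apply: eq_bigr => w _.
by rewrite expr1n scale1r.
Qed.

End Tableaux.

Definition block (m N k : nat) : nat := if (m <= k < m + N)%N then m else k.

Definition block2 (m a s k : nat) : nat :=
  if (m <= k < m + a)%N then m
  else if (m + a <= k < m + a + s)%N then (m + a)%N else k.

Lemma monotone_block m N : monotone (block m N).
Proof. by move=> k l kl; rewrite /block; do ?case: ifP; lia. Qed.

Section Blocks.
Context {n : nat}.
Implicit Types (w : 'S_n) (k l : 'I_n).

Lemma parab_blockP m N w : reflect
  (forall k, ~~ (m <= k < m + N)%N -> w k = k) (w \in parab (block m N)).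
Proof.
apply: (iffP (parabP _ _)) => h k.
  move=> hk; apply: val_inj => /=; have := h k; rewrite /block (negPf hk).
  by case: ifP => //; move: hk; lia.
rewrite /block; case: (boolP (m <= k < m + N)%N) => hk; last first.
  by rewrite h // (negPf hk).
case: ifPn => // hwk; have /perm_inj e := h _ hwk.
by move: hwk; rewrite e hk.
Qed.

Lemma parab_block_in m N w k : w \in parab (block m N) ->
  (m <= k < m + N)%N -> (m <= w k < m + N)%N.
Proof.
move=> /parab_blockP h hk; apply: contraTT hk => hwk.
by have /perm_inj e := h _ hwk; move: hwk; rewrite e.
Qed.

Lemma D_setE m a s : (m + (a + s) <= n)%N ->
  D_set n m [:: a; s] = min_reps (block2 m a s) (block m (a + s)).
Proof.
move=> hn; apply/setP => w; rewrite inE [RHS]inE; congr (_ && _).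
  apply/idP/idP => [/fintype.subsetP h | /parab_blockP h].
    apply/parab_blockP => k hk; apply/eqP; apply: contraNT hk => hk.
    by have := h k hk; rewrite inE /= addn0.
  apply/fintype.subsetP => k; rewrite !inE /= addn0 => hk.
  by apply: contraNT hk => /h/eqP.
have pos_lt' (x : box [:: a; s]) : (initial_filling m x < n)%N.
  have := initial_filling_lt x; rewrite /initial_filling /= => h.
  by apply: leq_trans hn; lia.
have actE (x : box [:: a; s]) k : initial_filling m x = k ->
    act_filling (@initial_filling m [:: a; s]) w x = w k.
  by rewrite /act_filling => ->; rewrite perm_natE.
have box_at (k r c : nat) : (c < nth 0 [:: a; s] r)%N ->
    k = (m + sumn (take r [:: a; s]) + c)%N ->
    exists x : box [:: a; s], [/\ brow x = r, bcol x = c & initial_filling m x = k].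
  move=> hc ->; have [x [hr hx]] := box_exists hc.
  by exists x; rewrite /initial_filling hr hx.
apply/forallP/incrP => h.
  move=> k l kl e.
  have [r [c [c' [hc hc' ek el]]]] : exists r c c', [/\ (c < nth 0 [:: a; s] r)%N,
      (c' < nth 0 [:: a; s] r)%N, k = (m + sumn (take r [:: a; s]) + c)%N :> nat &
      l = (m + sumn (take r [:: a; s]) + c')%N :> nat].
    move: e; rewrite /block2.
    case: (boolP (m <= k < m + a)%N) => hk1.
      exists 0%N, (k - m)%N, (l - m)%N; rewrite /=.
      by move: e; do ?case: ifP; split; lia.
    case: (boolP (m + a <= k < m + a + s)%N) => hk2; last first.
      by do ?case: ifP; lia.
    exists 1%N, (k - (m + a))%N, (l - (m + a))%N; rewrite /=.
    by move: e; do ?case: ifP; split; lia.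
  have [x [rx cx px]] := box_at _ _ _ hc ek.
  have [y [ry cy py]] := box_at _ _ _ hc' el.
  have /forallP/(_ y) := h x; rewrite (actE x k) // (actE y l) //.
  rewrite rx ry cx cy eqxx /= => /implyP; apply.
  by move: kl; rewrite ek el ltn_add2l.
move=> x; apply/forallP => y; apply/implyP => /andP [/eqP e xy].
rewrite (actE x (Ordinal (pos_lt' x))) // (actE y (Ordinal (pos_lt' y))) //.
apply: h; first by rewrite /= /initial_filling e ltn_add2l.
have := bcol_lt x; have := bcol_lt y; rewrite /= /initial_filling -e.
have : (brow x < 2)%N by rewrite /brow; case: (tag x).
by case: (brow x) => [|[|//]] _ /=; rewrite /block2;
   do ?case: ifP; lia.
Qed.

End Blocks.

(** * Shuffles *)

Definition cycle_nat (m N k : nat) : nat :=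
  if k == (m + N)%N then m else if (m <= k < m + N)%N then k.+1 else k.

Definition cycle_natV (m N k : nat) : nat :=
  if k == m then (m + N)%N else if (m < k <= m + N)%N then k.-1 else k.

Section Shuffles.
Context {n : nat}.
Implicit Types (u v w x y : 'S_n) (k l : 'I_n).

Lemma perm_of_nat (f : nat -> nat) :
  (forall k : nat, (k < n)%N -> (f k < n)%N) ->
  (forall k l : nat, (k < n)%N -> (l < n)%N -> f k = f l -> k = l) ->
  exists w, forall k, w k = f k :> nat.
Proof.
move=> flt finj; pose g k : 'I_n := Ordinal (flt k (ltn_ord k)).
have ginj : injective g.
  move=> k l /(congr1 val) /= e; apply: val_inj.
  exact: finj (ltn_ord k) (ltn_ord l) e.
by exists (perm ginj) => k; rewrite permE.
Qed.

Lemma cycle_exists m N : (m + N < n)%N -> exists x,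
  (forall k, x k = cycle_nat m N k :> nat) /\
  (forall k, (x^-1)%g k = cycle_natV m N k :> nat).
Proof.
move=> hn; have [||x hx] := @perm_of_nat (cycle_nat m N).
- by move=> k hk; rewrite /cycle_nat; do ?case: ifP; lia.
- by move=> k l hk hl; rewrite /cycle_nat; do ?case: ifP; lia.
exists x; split=> // k; have := hx ((x^-1)%g k); rewrite permKV.
by rewrite /cycle_nat /cycle_natV; do ?case: ifP; lia.
Qed.

Definition shuffles m a s : {set 'S_n} :=
  min_reps (block2 m a s) (block m (a + s)).

Lemma shufflesP m a s w : reflect
  [/\ forall k, (k < m)%N || (m + a + s <= k)%N -> w k = k,
      forall k l, (m <= k)%N -> (k < l)%N -> (l < m + a)%N -> (w k < w l)%N &
      forall k l, (m + a <= k)%N -> (k < l)%N -> (l < m + a + s)%N ->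
        (w k < w l)%N] (w \in shuffles m a s).
Proof.
rewrite inE; apply: (iffP andP) => [[/parab_blockP h1 /incrP h2] | [h1 h2 h3]].
  split=> [k hk | k l hk hl hkl | k l hk hl hkl]; first by apply: h1; lia.
    by apply: h2 => //; rewrite /block2; do ?case: ifP; lia.
  by apply: h2 => //; rewrite /block2; do ?case: ifP; lia.
split; first by apply/parab_blockP => k hk; apply: h1; lia.
apply/incrP => k l kl e; case: (boolP (m <= k < m + a)%N) => hk.
  by apply: h2 => //; move: e; rewrite /block2; do ?case: ifP; lia.
by apply: h3 => //; move: e; rewrite /block2; do ?case: ifP; lia.
Qed.

Lemma shuffles_parab m a s w :
  w \in shuffles m a s -> w \in parab (block m (a + s)).
Proof. by rewrite inE => /andP []. Qed.

Lemma shuffles_in m a s w k : w \in shuffles m a s ->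
  (m <= k < m + a + s)%N -> (m <= w k < m + a + s)%N.
Proof. by move=> /shuffles_parab; rewrite -addnA; apply: parab_block_in. Qed.

Lemma shuffles_fix m a s w (m0 : 'I_n) : m0 = m :> nat ->
  (w \in shuffles m a.+1 s) && (w m0 == m0) = (w \in shuffles m.+1 a s).
Proof.
move=> em; apply/andP/idP => [[/shufflesP [h1 h2 h3] /eqP wm] | hw].
  apply/shufflesP; split=> [k hk | k l hk hl hkl | k l hk hl hkl].
  - have [->|km] := eqVneq k m0; first by [].
    by apply: h1; move: km; rewrite -val_eqE /=; lia.
  - by apply: h2; lia.
  - by apply: h3; lia.
case/shufflesP: (hw) => h1 h2 h3.
have wm : w m0 = m0 by apply: h1; lia.
split; last by rewrite wm.
apply/shufflesP; split=> [k hk | k l hk hl hkl | k l hk hl hkl].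
- by apply: h1; lia.
- have [km|km] := eqVneq k m0.
    by have := shuffles_in (k := l) hw; rewrite km wm => /(_ _)/wrap[]; lia.
  by apply: h2; move: km; rewrite -?val_eqE /=; lia.
- by apply: h3; lia.
Qed.

Lemma shuffles_cycle m a s x v (m0 : 'I_n) : m0 = m :> nat ->
  (forall k, x k = cycle_nat m a.+1 k :> nat) ->
  (forall k, (x^-1)%g k = cycle_natV m a.+1 k :> nat) ->
  (m + a + s + 1 < n)%N ->
  ((x * v)%g \in shuffles m a.+1 s.+1) && ((x * v)%g m0 != m0) =
  (v \in shuffles m.+1 a.+1 s).
Proof.
move=> em hx hxV hn.
have xE k l : x k = l :> nat -> x k = l by move=> e; apply: val_inj.
apply/andP/idP => [[hw wm] | hv].
  have vE k : v k = (x * v)%g ((x^-1)%g k) by rewrite permM permKV.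
  move: hw wm vE; set w := (x * v)%g; set xV := (x^-1)%g in hxV *.
  move=> hw wm vE; case/shufflesP: (hw) => h1 h2 h3.
  have hn2 : (m + a.+1 < n)%N by lia.
  have wE : w (Ordinal hn2) = m0.
    pose j := (w^-1)%g m0; have wj : w j = m0 by rewrite permKV.
    have jm : j <> m0 by move=> e; move: wm; rewrite -{1}e wj eqxx.
    have jm' : j <> m0 :> nat by move=> e; apply: jm; apply: val_inj.
    have jin : (m <= j < m + a.+1 + s.+1)%N.
      case: (boolP (m <= j < m + a.+1 + s.+1)%N) => // hj.
      by case: jm; rewrite -wj h1 //; lia.
    have [jl|jl] := ltnP j (m + a.+1).
      have := h2 m0 j; rewrite wj em => h; have := shuffles_in (k := m0) hw.
      by move: h; rewrite em; lia.
    have [<- // | /eqP nj] := eqVneq j (Ordinal hn2).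
    have nj' : j <> (m + a.+1)%N :> nat by move=> e; apply: nj; apply: val_inj.
    have := h3 (Ordinal hn2) j; rewrite wj em /= => h.
    by have := shuffles_in (k := Ordinal hn2) hw; rewrite /=; lia.
  apply/shufflesP; split=> [k hk | k l hk hl hkl | k l hk hl hkl].
  - rewrite vE; have := hxV k; rewrite /cycle_natV.
    case: ifP => [/eqP km /= | km].
      move=> e; have -> : xV k = Ordinal hn2 by apply: val_inj; rewrite /= e.
      by rewrite wE; apply: val_inj; rewrite /= km.
    rewrite ifF; last by lia.
    by move=> /val_inj ->; apply: h1; lia.
  - rewrite !vE; apply: h2; rewrite !hxV /cycle_natV; by do ?case: ifP; lia.
  - rewrite !vE; apply: h3; rewrite !hxV /cycle_natV; by do ?case: ifP; lia.
case/shufflesP: (hv) => h1 h2 h3.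
have vm : v m0 = m0 by apply: h1; lia.
split; last first.
  rewrite permM -{2}vm (inj_eq perm_inj) -val_eqE /= hx em /cycle_nat.
  by do ?case: ifP; lia.
apply/shufflesP; split=> [k hk | k l hk hl hkl | k l hk hl hkl]; rewrite !permM.
- rewrite (xE k k) ?h1 //; first by lia.
  by rewrite hx /cycle_nat; do ?case: ifP; lia.
- by apply: h2; rewrite !hx /cycle_nat; do ?case: ifP; lia.
have [km|km] := eqVneq (k : nat) (m + a.+1)%N.
  rewrite (xE k m0); last by rewrite hx em /cycle_nat; do ?case: ifP; lia.
  rewrite (xE l l); last by rewrite hx /cycle_nat; do ?case: ifP; lia.
  by have := shuffles_in (k := l) hv; rewrite vm; lia.
by apply: h3; rewrite !hx /cycle_nat; do ?case: ifP; lia.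
Qed.

Lemma shuffles_shift m a s y w : (m + a + s < n)%N ->
  (forall k, y k = cycle_nat m (a + s) k :> nat) ->
  (forall k, (y^-1)%g k = cycle_natV m (a + s) k :> nat) ->
  ((w ^ y)%g \in shuffles m.+1 a s) = (w \in shuffles m a s).
Proof.
move=> hn hy hyV.
have vE k : (w ^ y)%g k = y (w ((y^-1)%g k)) by rewrite conjgE !permM.
apply/idP/idP => [hv | hw].
  have wE k : w k = (y^-1)%g ((w ^ y)%g (y k)) by rewrite vE !permK.
  case/shufflesP: (hv) => h1 h2 h3.
  have yVmono k l : (m < k)%N -> (k < l)%N -> (l < m.+1 + a + s)%N ->
      ((y^-1)%g k < (y^-1)%g l)%N.
    by move=> *; rewrite !hyV /cycle_natV; do ?case: ifP; lia.
  apply/shufflesP; split=> [k hk | k l hk hl hkl | k l hk hl hkl]; rewrite !wE.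
  - rewrite h1 ?permK // hy /cycle_nat; by do ?case: ifP; lia.
  - have yk : y k = k.+1 :> nat by rewrite hy /cycle_nat; do ?case: ifP; lia.
    have yl : y l = l.+1 :> nat by rewrite hy /cycle_nat; do ?case: ifP; lia.
    have ik := shuffles_in (k := y k) hv; have il := shuffles_in (k := y l) hv.
    by apply: yVmono; [lia | apply: h2; lia | lia].
  - have yk : y k = k.+1 :> nat by rewrite hy /cycle_nat; do ?case: ifP; lia.
    have yl : y l = l.+1 :> nat by rewrite hy /cycle_nat; do ?case: ifP; lia.
    have ik := shuffles_in (k := y k) hv; have il := shuffles_in (k := y l) hv.
    by apply: yVmono; [lia | apply: h3; lia | lia].
case/shufflesP: (hw) => h1 h2 h3.
have ymono k l : (m <= k)%N -> (k < l)%N -> (l < m + a + s)%N -> (y k < y l)%N.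
  by move=> *; rewrite !hy /cycle_nat; do ?case: ifP; lia.
apply/shufflesP; split=> [k hk | k l hk hl hkl | k l hk hl hkl]; rewrite !vE.
- rewrite h1 ?permKV // hyV /cycle_natV; by do ?case: ifP; lia.
- have yk : (y^-1)%g k = k.-1 :> nat by rewrite hyV /cycle_natV; do ?case: ifP; lia.
  have yl : (y^-1)%g l = l.-1 :> nat by rewrite hyV /cycle_natV; do ?case: ifP; lia.
  have ik := shuffles_in (k := (y^-1)%g k) hw.
  have il := shuffles_in (k := (y^-1)%g l) hw.
  by apply: ymono; [lia | apply: h2; lia | lia].
- have yk : (y^-1)%g k = k.-1 :> nat by rewrite hyV /cycle_natV; do ?case: ifP; lia.
  have yl : (y^-1)%g l = l.-1 :> nat by rewrite hyV /cycle_natV; do ?case: ifP; lia.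
  have ik := shuffles_in (k := (y^-1)%g k) hw.
  have il := shuffles_in (k := (y^-1)%g l) hw.
  by apply: ymono; [lia | apply: h3; lia | lia].
Qed.

End Shuffles.

(** * Garnir relations and straightening *)

Section Garnir.
Context {R : comPzRingType} (q : R) {n : nat}.
Implicit Types (u v w x y : 'S_n) (k l : 'I_n).
Local Notation H := (hecke q n).
Local Notation T i := (hT q i).
Local Notation Tw w := (hTw q w).

Definition shuffle_sum m a s : H := \sum_(w in shuffles m a s) Tw w.

Lemma C_elt_shuffles m a s : (m + (a + s) <= n)%N ->
  C_elt q n m [:: a; s] = shuffle_sum m a s.
Proof. by move=> h; rewrite /C_elt D_setE. Qed.

Lemma shuffle_sum_pascal m a s x :
  (forall k, x k = cycle_nat m a.+1 k :> nat) ->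
  (forall k, (x^-1)%g k = cycle_natV m a.+1 k :> nat) ->
  (m + a + s + 1 < n)%N ->
  shuffle_sum m a.+1 s.+1 = shuffle_sum m.+1 a s.+1 + Tw x * shuffle_sum m.+1 a.+1 s.
Proof.
move=> hx hxV hn; have hm : (m < n)%N by lia.
rewrite /shuffle_sum (bigID (fun w : 'S_n => w (Ordinal hm) == Ordinal hm)) /=.
congr (_ + _).
  by apply: eq_bigl => w; apply: shuffles_fix.
rewrite (reindex_inj (mulgI x)) mulr_sumr /=; apply: eq_big => v.
  exact: shuffles_cycle.
rewrite (shuffles_cycle v _ hx hxV hn) // => hv.
apply/hTw_additive/(inv_parab_mulr (@monotone_block m.+1 (a.+1 + s))).
  exact: shuffles_parab.
apply/incrP => k l kl; rewrite !hxV /block /cycle_natV.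
by do ?case: ifP; lia.
Qed.

Lemma shuffle_sum_shift m a s y : (m + a + s < n)%N ->
  (forall k, y k = cycle_nat m (a + s) k :> nat) ->
  (forall k, (y^-1)%g k = cycle_natV m (a + s) k :> nat) ->
  shuffle_sum m a s * Tw y = Tw y * shuffle_sum m.+1 a s.
Proof.
move=> hn hy hyV; rewrite /shuffle_sum mulr_suml mulr_sumr.
rewrite [RHS](reindex_inj (conjg_inj y)) /=; apply: eq_big => w.
  by rewrite (shuffles_shift w hn hy hyV).
move=> hw; rewrite -!hTw_additive.
- by rewrite conjgE !mulgA mulgV mul1g.
- apply: (inv_parab_mulr (@monotone_block m.+1 (a + s))).
    by apply: shuffles_parab; rewrite (shuffles_shift w hn hy hyV).
  apply/incrP => k l kl; rewrite !hyV /block /cycle_natV.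
  by do ?case: ifP; lia.
apply: (inv_parab_mul (@monotone_block m (a + s))).
  exact: shuffles_parab.
apply/incrP => k l kl; rewrite !hy /block /cycle_nat.
by do ?case: ifP; lia.
Qed.

Lemma cycle_mul m a s x y' y :
  (forall k, x k = cycle_nat m a k :> nat) ->
  (forall k, y' k = cycle_nat (m + a) s k :> nat) ->
  (forall k, y k = cycle_nat m (a + s) k :> nat) ->
  Tw y = Tw y' * Tw x.
Proof.
move=> hx hy' hy.
have -> : y = (y' * x)%g.
  apply/permP => k; apply: val_inj; rewrite permM /= hy hx hy' /cycle_nat.
  by do ?case: ifP; lia.
apply/hTw_additive/(inv_parab_mul (@monotone_block (m + a) s.+1)).
  apply/parab_blockP => k hk; apply: val_inj; rewrite /= hy' /cycle_nat.
  by do ?case: ifP; lia.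
apply/incrP => k l kl; rewrite !hx /block /cycle_nat.
by do ?case: ifP; lia.
Qed.

(* Peeling off the smallest letter of the first block gives
   C(m; a, s) = C(m+1; a-1, s) + T_x C(m+1; a, s-1), and the second summand is,
   up to a power of q absorbed by the row symmetrizer, C(m; a, s-1) T_y. *)
Lemma garnir_mem (q' : R) (qq' : q * q' = 1) (b : nat -> nat) (m0 N M : nat)
    (P : H -> Prop) : monotone b ->
  (forall k l : nat, (m0 + N <= k < m0 + N + M)%N ->
    (m0 + N <= l < m0 + N + M)%N -> b k = b l) ->
  (m0 + N + M <= n)%N -> (M <= N)%N -> submodule P ->
  (forall t h, (0 < t <= M)%N -> P (parab_sum q 1 b * shuffle_sum m0 N t * h)) ->
  forall (k s : nat) h, (k < s <= M)%N ->
    P (parab_sum q 1 b * shuffle_sum (m0 + k) (N - k) s * h).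
Proof.
move=> mb hb hn MN hP hC k; elim: k => [|k IH] s h hs.
  by rewrite addn0 subn0; apply: hC.
case: s hs => // s hs; have [a ea] : exists a, (N - k)%N = a.+1.
  by exists (N - k).-1; lia.
have [x [hx hxV]] := @cycle_exists n (m0 + k) a.+1 ltac:(lia).
have [y [hy hyV]] := @cycle_exists n (m0 + k) (a.+1 + s) ltac:(lia).
have [y' [hy' _]] := @cycle_exists n (m0 + N) s ltac:(lia).
have mN : (m0 + k + a.+1)%N = (m0 + N)%N by lia.
have -> : (N - k.+1)%N = a by lia.
have hpas := shuffle_sum_pascal hx hxV (s := s) ltac:(lia).
have hshift := shuffle_sum_shift (m := m0 + k) (a := a.+1) (s := s) ltac:(lia) hy hyV.
have hTy : Tw y = Tw y' * Tw x.
  by apply: (@cycle_mul (m0 + k) a.+1 s) => //; rewrite mN.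
have hmy : parab_sum q 1 b * Tw y' = q ^+ inv y' *: parab_sum q 1 b.
  apply: parab_sum1_mul_hTw => //; apply/parabP => l; rewrite hy' /cycle_nat.
  case: ifP => [/eqP -> | _]; first by apply: hb; lia.
  by case: ifP => // hl; apply: hb; lia.
have e : parab_sum q 1 b * shuffle_sum (m0 + k).+1 a s.+1 * h =
    parab_sum q 1 b * shuffle_sum (m0 + k) a.+1 s.+1 * h -
    q' ^+ inv y' *: (parab_sum q 1 b * shuffle_sum (m0 + k) a.+1 s * (Tw y * h)).
  rewrite hpas (mulrDr (parab_sum q 1 b)) mulrDl.
  suff -> : q' ^+ inv y' *: (parab_sum q 1 b * shuffle_sum (m0 + k) a.+1 s * (Tw y * h)) =
    parab_sum q 1 b * (Tw x * shuffle_sum (m0 + k).+1 a.+1 s) * h by rewrite addrK.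
  rewrite -[parab_sum q 1 b * shuffle_sum (m0 + k) a.+1 s * _]mulrA.
  rewrite (mulrA (shuffle_sum (m0 + k) a.+1 s)) hshift hTy !mulrA hmy.
  rewrite -!hecke_scalerAl scalerA -exprMn (mulrC q') qq' expr1n.
  by rewrite scale1r.
rewrite addnS e; apply: submoduleB => //.
  by rewrite -ea; apply: IH; lia.
by case: (hP) => _ _ PZ; apply: PZ; rewrite -ea; apply: IH; lia.
Qed.

Lemma straighten (q' : R) (qq' : q * q' = 1) (mu : seq nat) (P : H -> Prop) :
  is_partition n mu -> submodule P ->
  (forall w, incr (row_of mu) w -> col_incr mu w -> P (m_elt q n mu * Tw w)) ->
  (forall d t h, (1 <= d < size mu)%N -> (1 <= t <= nth 0%N mu d)%N ->
    P (m_elt q n mu * h_elt q n mu d t * h)) ->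
  forall h, P (m_elt q n mu * h).
Proof.
move=> [mu_sorted mu_n] hP hstd hh; apply: hTw_ind; first exact: submodule_mull.
have mb := @monotone_row_of mu; have hm := m_eltE mu_n q.
have nthle := nth_sorted_geq mu_sorted.
move=> w; move: {2}(inv w) (leqnn (inv w)) => e.
elim: e w => [|e IH] w we.
  have -> : w = 1%g by apply: inv_eq0; lia.
  apply: hstd; first by apply/incrP => k l; rewrite !perm1.
  apply/col_incrP => k l ekl; rewrite !perm1 => rkl.
  by rewrite ltnNge; apply/negP => /mb; lia.
case: (boolP (incr (row_of mu) w)) => [iw | /(incrN_descent mb) [i bi wi]];
    last first.
  rewrite (hTw_descent _ wi) mulrA hm parab_sum1_mul_T // -hecke_scalerAl -hm.
  by case: (hP) => _ _ PZ; apply: PZ; apply: IH; have := inv_simple_transpN wi; lia.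
case: (boolP (col_incr mu w)) => [|cw]; first exact: hstd.
have [k [l [rkl ckl wkl]]] : exists k l, [/\ row_of mu l = (row_of mu k).+1,
    col_of mu k = col_of mu l & (w l < w k)%N].
  apply: contrapT => hno; case/negP: cw; apply/col_incrP => k l.
  move: {2}(row_of mu l - row_of mu k)%N
    (erefl (row_of mu l - row_of mu k)%N) => d.
  elim: d l => [|d IHd] l ed ckl rkl; first by lia.
  have kn : (k < sumn mu)%N by rewrite mu_n.
  have ln : (l < sumn mu)%N by rewrite mu_n.
  have [r er] : exists r, row_of mu l = r.+1 by exists (row_of mu l).-1; lia.
  have cr : (col_of mu l < nth 0%N mu r)%N.
    by apply: leq_trans (col_of_lt ln) _; apply: nthle; lia.
  have hp := pos_lt cr; rewrite mu_n in hp.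
  pose l' := Ordinal hp.
  have rl' : row_of mu l' = r by apply: row_of_pos.
  have cl' : col_of mu l' = col_of mu l by apply: col_of_pos.
  have w1 : (w l' < w l)%N.
    rewrite ltnNge; apply/negP => hle; apply: hno; exists l', l.
    split; rewrite ?rl' //; move: hle; rewrite leq_eqVlt => /orP [|//].
    move=> /eqP/val_inj/perm_inj el; move: er; rewrite el rl'; lia.
  have [e'|e'] := eqVneq (row_of mu l') (row_of mu k).
    have -> // : k = l'; apply: val_inj => /=.
    by rewrite -(row_colK kn) ckl -e' rl'.
  have := IHd l'; rewrite rl' cl'; lia.
set r := row_of mu k in rkl; set c := col_of mu k in ckl.
have kn : (k < sumn mu)%N by rewrite mu_n.
have ln : (l < sumn mu)%N by rewrite mu_n.
pose m0 := sumn (take r mu); pose N := nth 0%N mu r; pose M := nth 0%N mu r.+1.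
have cN : (c < N)%N by apply: col_of_lt.
have cM : (c < M)%N by rewrite ckl /M -rkl; apply: col_of_lt.
have MN : (M <= N)%N by apply: nthle.
have rs : (r.+1 < size mu)%N.
  by have := row_of_size ln; rewrite rkl.
have take_r : sumn (take r.+1 mu) = (m0 + N)%N.
  by rewrite (take_nth 0%N) ?sumn_rcons //; lia.
have hn : (m0 + N + M <= n)%N.
  rewrite -mu_n -(cat_take_drop r.+2 mu) sumn_cat (take_nth 0%N) //.
  by rewrite sumn_rcons take_r leq_addr.
have kE : (m0 + c)%N = k by apply: row_colK.
have lE : (m0 + N + c)%N = l by rewrite -(row_colK ln) rkl take_r ckl.
have row1 (z : 'I_n) : (m0 <= z < m0 + N)%N -> row_of mu z = r.
  move=> hz; rewrite -(@row_of_pos mu r (z - m0)); last by rewrite -/N; lia.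
  by congr row_of; rewrite -/m0; lia.
have row2 z : (m0 + N <= z < m0 + N + M)%N -> row_of mu z = r.+1.
  move=> hz; rewrite -(@row_of_pos mu r.+1 (z - (m0 + N))); last by rewrite -/M; lia.
  by congr row_of; rewrite take_r; lia.
have [u0 [v [hu0 hv ew iw']]] := parab_decomp w (@monotone_block (m0 + c) (N - c + c.+1)).
have hw (z z' : 'I_n) : (m0 + c <= z < m0 + c + (N - c + c.+1))%N ->
    (m0 + c <= z' < m0 + c + (N - c + c.+1))%N ->
    (w z < w z')%N -> (u0 z < u0 z')%N.
  move=> hz hz'; rewrite ew !permM => h.
  have h1 := parab_block_in hu0 hz; have h2 := parab_block_in hu0 hz'.
  have [//|le] := ltnP (u0 z) (u0 z').
  have [e'|ne] := eqVneq (u0 z) (u0 z'); first by rewrite e' in h; lia.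
  have lt : (u0 z' < u0 z)%N by move: ne; rewrite -val_eqE /=; lia.
  move/incrP: hv => /(_ _ _ lt) hv'.
  have : (v (u0 z') < v (u0 z))%N by apply: hv'; rewrite /block h1 h2.
  lia.
have winc (z z' : 'I_n) : (z < z')%N -> row_of mu z = row_of mu z' -> (w z < w z')%N.
  exact: (elimT (incrP _ _) iw).
have hu0s : u0 \in shuffles (m0 + c) (N - c) c.+1.
  apply/shufflesP; split=> [z hz | z z' hz zz hz' | z z' hz zz hz'].
  - by move/parab_blockP: hu0; apply; lia.
  - by apply: hw; [lia | lia | apply: winc; rewrite ?row1 //; lia].
  - by apply: hw; [lia | lia | apply: winc; rewrite ?row2 //; lia].
have u0_inv (z z' : 'I_n) : (m0 + c <= z < m0 + N)%N ->
    (m0 + N <= z' <= m0 + N + c)%N -> (u0 z' < u0 z)%N.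
  move=> hz hz'; apply: hw; try lia.
  have : (w k <= w z)%N.
    have [->//|nk] := eqVneq k z; apply/ltnW/winc; last by rewrite (row1 z) //; lia.
    by move: nk; rewrite -val_eqE /=; lia.
  have : (w z' <= w l)%N.
    have [->//|nl] := eqVneq z' l; apply/ltnW/winc; last by rewrite (row2 z') ?rkl //; lia.
    by move: nl; rewrite -val_eqE /=; lia.
  lia.
have hlen u : u \in shuffles (m0 + c) (N - c) c.+1 -> u != u0 ->
    (inv u < inv u0)%N.
  move=> hu nu; have sub : inv_set u \subset inv_set u0.
    apply/fintype.subsetP => -[z z']; rewrite !inE /= => /andP [zz uz].
    rewrite zz /=; case/shufflesP: (hu) => h1 h2 h3.
    have hin (z0 : 'I_n) : ~~ (m0 + c <= z0 < m0 + c + (N - c) + c.+1)%N ->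
      u z0 = z0 by move=> h0; apply: h1; lia.
    case: (boolP (m0 + c <= z < m0 + c + (N - c) + c.+1)%N) => hz;
      case: (boolP (m0 + c <= z' < m0 + c + (N - c) + c.+1)%N) => hz'.
    - apply: u0_inv.
        have [hzN|hzN] := ltnP z (m0 + N); first by lia.
        by have := h3 z z'; lia.
      have [hzN|hzN] := leqP (m0 + N) z'; first by lia.
      by have := h2 z z'; lia.
    - by have := shuffles_in hu hz; move: uz; rewrite (hin z') //; lia.
    - by have := shuffles_in hu hz'; move: uz; rewrite (hin z) //; lia.
    - by move: uz; rewrite !hin //; lia.
  have := inv_additive sub; case: (posnP (inv (u^-1 * u0))) => [/inv_eq0 e'|]; last by lia.
  by case/eqP: nu; rewrite -(mulKVg u u0) e' mulg1.
have hG : P (m_elt q n mu * shuffle_sum (m0 + c) (N - c) c.+1 * Tw v).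
  rewrite hm; apply: (garnir_mem qq' (M := M)) => //; last by lia.
    by move=> z z' hz hz'; rewrite !row2.
  move=> t h ht; rewrite -hm.
  have := hh r.+1 t h; rewrite /h_elt /= -/m0 -/N C_elt_shuffles; last by lia.
  by apply; lia.
have e' : m_elt q n mu * Tw w = m_elt q n mu * shuffle_sum (m0 + c) (N - c) c.+1 * Tw v -
   \sum_(u in shuffles (m0 + c) (N - c) c.+1 | u != u0)
     m_elt q n mu * Tw (u * v)%g.
  have -> : m_elt q n mu * shuffle_sum (m0 + c) (N - c) c.+1 * Tw v =
      \sum_(u in shuffles (m0 + c) (N - c) c.+1) m_elt q n mu * Tw (u * v)%g.
    rewrite -mulrA -mulr_sumr; congr (_ * _); rewrite [LHS]mulr_suml.
    apply: eq_bigr => u hu; rewrite hTw_additive //.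
    exact: inv_parab_mul (@monotone_block _ _) (shuffles_parab hu) hv.
  by rewrite (bigD1 u0) //= -ew addrK.
rewrite e'; apply: submoduleB => //; apply: submodule_sum => // u /andP [hu nu].
apply: IH; rewrite (inv_parab_mul (@monotone_block _ _) (shuffles_parab hu) hv).
by have := hlen u hu nu; rewrite iw' in we; lia.
Qed.

End Garnir.

(** * Compositions *)

Section Compositions.
Implicit Types (A B mu nu la : seq nat) (a b t k r : nat).

Lemma row_of_cat2 A a b B k : row_of (A ++ [:: a, b & B]) k =
  if (k < sumn A)%N then row_of A k
  else if (k < sumn A + a)%N then size A
  else if (k < sumn A + a + b)%N then (size A).+1
  else (size A + (row_of B (k - (sumn A + a + b))).+2)%N.
Proof.
rewrite row_of_cat /=; case: ltnP => // hA.
have -> : (k - sumn A < a)%N = (k < sumn A + a)%N by lia.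
case: ifP => ha; first by rewrite addn0.
have -> : (k - sumn A - a < b)%N = (k < sumn A + a + b)%N by lia.
by case: ifP => hb; rewrite ?addn1 // !subnDA.
Qed.

Lemma row_of_cat3 A a t b B k : row_of (A ++ [:: a, t, b & B]) k =
  if (k < sumn A)%N then row_of A k
  else if (k < sumn A + a)%N then size A
  else if (k < sumn A + a + t)%N then (size A).+1
  else if (k < sumn A + a + t + b)%N then (size A).+2
  else (size A + (row_of B (k - (sumn A + a + t + b))).+3)%N.
Proof.
rewrite row_of_cat2 /=; case: ltnP => // h1; case: ltnP => // h2.
case: ltnP => // h3.
have -> : (k - (sumn A + a + t) < b)%N = (k < sumn A + a + t + b)%N by lia.
by case: ltnP => h4; rewrite ?addn2 // -!subnDA.
Qed.

Fixpoint row_weight nu : nat :=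
  if nu is _ :: nu' then (sumn nu' + row_weight nu')%N else 0%N.

Lemma row_weight_cat A mu nu : sumn mu = sumn nu ->
  (row_weight mu < row_weight nu)%N ->
  (row_weight (A ++ mu) < row_weight (A ++ nu))%N.
Proof.
by move=> e lt; elim: A => [//|a A IH] /=; rewrite !sumn_cat e ltn_add2l.
Qed.

Lemma row_weight_move A a b B t : (0 < t <= b)%N ->
  (row_weight (A ++ [:: (a + t)%N, (b - t)%N & B]) <
   row_weight (A ++ [:: a, b & B]))%N.
Proof. by move=> ht; apply: row_weight_cat => /=; lia. Qed.

Lemma sumn_move A a b B t : (t <= b)%N ->
  sumn (A ++ [:: (a + t)%N, (b - t)%N & B])%N = sumn (A ++ [:: a, b & B]).
Proof. by move=> ht; rewrite !sumn_cat /=; lia. Qed.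

Lemma dominates_cat A mu nu :
  dominates mu nu -> dominates (A ++ mu) (A ++ nu).
Proof.
move=> h; elim: A => [//|a A IH] [|j] //=; by rewrite leq_add2l.
Qed.

Lemma dominates_move A a b B t : (t <= b)%N ->
  dominates (A ++ [:: (a + t)%N, (b - t)%N & B]) (A ++ [:: a, b & B]).
Proof.
move=> ht; apply: dominates_cat => -[|[|j]] //=; first by lia.
by lia.
Qed.

Lemma dominates_trans la mu nu :
  dominates la mu -> dominates mu nu -> dominates la nu.
Proof. by move=> h1 h2 j; apply: leq_trans (h2 j) (h1 j). Qed.

Lemma sumn_takeS mu j : sumn (take j.+1 mu) = (sumn (take j mu) + nth 0 mu j)%N.
Proof.
elim: mu j => [|a mu IH] [|j] //=; first by rewrite take0 /= addn0.
by rewrite IH addnA.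
Qed.

Lemma strictly_dominatesP la mu : strictly_dominates la mu <->
  dominates la mu /\ exists j, (sumn (take j mu) < sumn (take j la))%N.
Proof.
split=> -[dom [j hj]]; split=> //; last first.
  apply: contrapT => h; suff e i : sumn (take i la) = sumn (take i mu).
    by rewrite e ltnn in hj.
  elim: i => [|i IH]; rewrite ?take0 // !sumn_takeS IH; congr addn.
  by apply: contrapT => hi; apply: h; exists i.
have [lt | ge] := ltnP (sumn (take j mu)) (sumn (take j la)); first by exists j.
exists j.+1; rewrite !sumn_takeS; have := dom j; have := dom j.+1.
by rewrite !sumn_takeS; lia.
Qed.

Lemma strictly_dominates_move A a b B t : (0 < t <= b)%N ->
  strictly_dominates (A ++ [:: (a + t)%N, (b - t)%N & B]) (A ++ [:: a, b & B]).
Proof.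
move=> ht; split; first by apply: dominates_move; lia.
by exists (size A); rewrite !nth_cat ltnn subnn /=; lia.
Qed.

Lemma dominates_strictly la mu nu :
  dominates la mu -> strictly_dominates mu nu -> strictly_dominates la nu.
Proof.
move=> h1 /strictly_dominatesP [h2 [j hj]]; apply/strictly_dominatesP.
split; first exact: dominates_trans h1 h2.
by exists j; apply: leq_trans (h1 j).
Qed.

Lemma not_sorted_geq nu : ~~ sorted geq nu ->
  exists A a b B, nu = A ++ [:: a, b & B] /\ (a < b)%N.
Proof.
elim: nu => [//|a [//|b nu] IH] /=; rewrite negb_and.
have [ab _ | ba /= h] := ltnP a b; first by exists [::], a, b, nu.
have [|A [a' [b' [B [-> lt]]]]] := IH; first by move: h; rewrite ?ba.
by exists (a :: A), a', b', B.
Qed.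

Lemma split_at r mu : (r.+1 < size mu)%N ->
  mu = take r mu ++ [:: nth 0 mu r, nth 0 mu r.+1 & drop r.+2 mu].
Proof.
move=> h; rewrite -{1}(cat_take_drop r mu) (drop_nth 0%N) ?(drop_nth 0%N h) //.
by lia.
Qed.

End Compositions.

Section ComposedSums.
Context {R : comPzRingType} (q : R) {n : nat}.
Implicit Types (u v w x y : 'S_n) (k l : 'I_n).
Local Notation H := (hecke q n).
Local Notation Tw w := (hTw q w).

Lemma parab_sum_conj (b b' : nat -> nat) x : monotone b -> monotone b' ->
  incr b x -> incr b' x^-1 ->
  (forall k l, b k = b l <-> b' (x k) = b' (x l)) ->
  parab_sum q 1 b * Tw x = Tw x * parab_sum q 1 b'.
Proof.
move=> mb mb' ix ixV hbb.
have hin u : ((u ^ x)%g \in parab b') = (u \in parab b).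
  apply/parabP/parabP => h k.
    by apply/hbb; have := h (x k); rewrite conjgE !permM permK.
  have := h ((x^-1)%g k); rewrite conjgE !permM => /hbb.
  by rewrite permKV.
rewrite /parab_sum mulr_suml mulr_sumr [RHS](reindex_inj (conjg_inj x)) /=.
apply: eq_big => u; first by rewrite hin.
move=> hu; rewrite !expr1n !scale1r -!hTw_additive.
- by rewrite conjgE !mulgA mulgV mul1g.
- by apply: (inv_parab_mulr mb'); rewrite ?hin.
exact: (inv_parab_mul mb).
Qed.

Lemma composition_swap (q' : R) (qq' : q * q' = 1) (A : seq nat) (a b : nat)
    (B : seq nat) : sumn (A ++ [:: a, b & B]) = n ->
  exists g h : H, m_elt q n (A ++ [:: a, b & B]) =
    g * m_elt q n (A ++ [:: b, a & B]) * h.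
Proof.
move=> hn; have hn' : sumn (A ++ [:: b, a & B]) = n.
  by rewrite -hn !sumn_cat /=; lia.
have hn2 : (sumn A + a + b <= n)%N by rewrite -hn sumn_cat /=; lia.
pose m := sumn A.
pose f (a b k : nat) := if (m <= k < m + a)%N then (k + b)%N
  else if (m + a <= k < m + a + b)%N then (k - a)%N else k.
have [||x hx] := @perm_of_nat n (f a b).
- by move=> k hk; rewrite /f; do ?case: ifP; lia.
- by move=> k l hk hl; rewrite /f; do ?case: ifP; lia.
have hxV k : (x^-1)%g k = f b a k :> nat.
  have := hx ((x^-1)%g k); rewrite permKV /f.
  by do ?case: ifP; lia.
have [h xh] := hTw_right_inverse x qq'.
exists (Tw x), h; rewrite !m_eltE // -(@parab_sum_conj (row_of (A ++ [:: a, b & B]))).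
- by rewrite -mulrA xh mulr1.
- exact: monotone_row_of.
- exact: monotone_row_of.
- apply/incrP => k l kl; rewrite !row_of_cat2 !hx /f -/m.
  have := @row_of_size A k; have := @row_of_size A l; rewrite -/m.
  by do ?case: ifP; lia.
- apply/incrP => k l kl; rewrite !row_of_cat2 !hxV /f -/m.
  have := @row_of_size A k; have := @row_of_size A l; rewrite -/m.
  by do ?case: ifP; lia.
have rx k : row_of (A ++ [:: b, a & B]) (x k) =
    swap_nat (size A) (row_of (A ++ [:: a, b & B]) k).
  rewrite !row_of_cat2 hx /f -/m (addnAC m b a) /swap_nat.
  by have := @row_of_size A k; rewrite -/m; do ?case: ifP; lia.
by move=> k l; rewrite !rx /swap_nat; do ?case: eqP; lia.
Qed.

Lemma parab_incr_fix (b : nat -> nat) w (c : nat) : w \in parab b ->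
  (forall k l, (k < l)%N -> b k = c -> b l = c -> (w k < w l)%N) ->
  forall k, b k = c -> w k = k.
Proof.
move=> /parabP hw inc; case=> k hk; elim/ltn_ind: k hk => k IH hk bk.
set k' : 'I_n := Ordinal hk; pose j := (w^-1)%g k'.
have wj : w j = k' by rewrite permKV.
have bj : b j = c by rewrite -hw wj.
have [jk | kj | ejk] := ltngtP (j : nat) k.
- have ej : j = Ordinal (ltn_ord j) by apply: val_inj.
  have wjj : w j = j by have := IH j jk (ltn_ord j) bj; rewrite -ej.
  have ekj : k' = j by rewrite -wjj wj.
  by rewrite ekj wjj.
- have lt := inc k' j kj bk bj; rewrite wj in lt.
  have bp : b (w k') = c by rewrite hw.
  have := IH (w k') lt (ltn_ord _) bp.
  have -> : Ordinal (ltn_ord (w k')) = w k' by apply: val_inj.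
  by move=> /perm_inj e; rewrite e ltnn in lt.
have e : j = k' by apply: val_inj.
by rewrite -{1}e wj.
Qed.

Lemma min_reps_move (A B : seq nat) (a b t : nat) : (t <= b)%N ->
  (sumn A + a + b <= n)%N ->
  min_reps (row_of (A ++ [:: a, t, (b - t)%N & B]))
    (row_of (A ++ [:: (a + t)%N, (b - t)%N & B])) =
  shuffles (sumn A) a t :> {set 'S_n}.
Proof.
move=> tb hn; apply/setP => w; rewrite [LHS]inE.
apply/andP/shufflesP => [[hw /incrP iw] | [h1 h2 h3]].
  have rowA (k : nat) := @row_of_size A k.
  split=> [k hk | k l hk hl hkl | k l hk hl hkl].
  - apply: (parab_incr_fix hw _ erefl) => z z' zz ez ez'.
    apply: iw => //; move: ez ez'; rewrite !row_of_cat3 !row_of_cat2.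
    have := rowA k; have := rowA z; have := rowA z'.
    have -> : (sumn A + (a + t) + (b - t) = sumn A + a + t + (b - t))%N by lia.
    by do ?case: ifP; lia.
  - by apply: iw => //; rewrite !row_of_cat3; do ?case: ifP; lia.
  - by apply: iw => //; rewrite !row_of_cat3; do ?case: ifP; lia.
have hw : w \in shuffles (sumn A) a t by apply/shufflesP.
have rowA (k : nat) := @row_of_size A k.
split.
  apply/parabP => k.
  case: (boolP (sumn A <= k < sumn A + a + t)%N) => hk; last first.
    by rewrite h1 //; lia.
  have := shuffles_in hw hk; rewrite !row_of_cat2.
  by do ?case: ifP; lia.
apply/incrP => k l kl.
case: (boolP ((k < sumn A) || (sumn A + a + t <= k))%N) => hk; last first.
  have [lin | lout] := ltnP l (sumn A + a + t).
    have [ka | ka] := ltnP k (sumn A + a).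
      have [la | la] := ltnP l (sumn A + a).
        by move=> _; apply: h2 => //; lia.
      by rewrite !row_of_cat3; do ?case: ifP; lia.
    by move=> _; apply: h3 => //; lia.
  by rewrite !row_of_cat3; do ?case: ifP; lia.
rewrite h1 //; case: (boolP ((l < sumn A) || (sumn A + a + t <= l))%N) => hl.
  by rewrite h1.
have lin : (sumn A <= l < sumn A + a + t)%N by lia.
by have := shuffles_in hw lin; lia.
Qed.

Lemma composition_move (A B : seq nat) (a b t : nat) : (t <= b)%N ->
  sumn (A ++ [:: a, b & B]) = n ->
  exists g : H, m_elt q n (A ++ [:: a, b & B]) * shuffle_sum q (sumn A) a t =
    g * m_elt q n (A ++ [:: (a + t)%N, (b - t)%N & B])%N.
Proof.
move=> tb hn; have hn' := sumn_move A a B tb; rewrite hn in hn'.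
have hAn : (sumn A + a + b <= n)%N by rewrite -hn sumn_cat /=; lia.
rewrite !m_eltE //; set bn := row_of _; set bn' := row_of _.
pose br := row_of (A ++ [:: a, t, (b - t)%N & B]).
have mr : monotone br by apply: monotone_row_of.
have rowA (k : nat) := @row_of_size A k.
have r1 : refines (n := n) br bn.
  move=> k l; rewrite /br /bn !row_of_cat3 !row_of_cat2.
  have := rowA k; have := rowA l.
  have -> : (sumn A + a + t + (b - t) = sumn A + a + b)%N by lia.
  by do ?case: ifP; lia.
have r2 : refines (n := n) br bn'.
  move=> k l; rewrite /br /bn' !row_of_cat3 !row_of_cat2.
  have := rowA k; have := rowA l.
  have -> : (sumn A + (a + t) + (b - t) = sumn A + a + t + (b - t))%N by lia.
  by do ?case: ifP; lia.
have e1 := parab_sum_factor q mr r1; have e2 := parab_sum_factor q mr r2.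
rewrite min_reps_move // in e2.
exists (hstar (\sum_(d in min_reps br bn) Tw d)).
rewrite e2 mulrA -(hstar_parab_sum q 1 br) -hstarM -e1.
by rewrite hstar_parab_sum.
Qed.

Lemma composition_span (q' : R) (qq' : q * q' = 1) (nu : seq nat)
    (P : H -> Prop) : sumn nu = n -> submodule P ->
  (forall la u w, is_partition n la -> dominates la nu ->
    incr (row_of la) u -> col_incr la u -> incr (row_of la) w -> col_incr la w ->
    P (hstar (Tw u) * m_elt q n la * Tw w)) ->
  forall g h, P (g * m_elt q n nu * h).
Proof.
have [e we] : exists e, (row_weight nu < e)%N by exists (row_weight nu).+1.
elim: e nu P we => [//|e IH] nu P we hn hP hstd g h.
have IHdom la : sumn la = n -> (row_weight la < row_weight nu)%N ->
    dominates la nu -> forall g h, P (g * m_elt q n la * h).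
  move=> hla lt dom; apply: IH => //; first by lia.
  move=> la' u w p dom' *; apply: hstd => //.
  exact: dominates_trans dom' dom.
case: (boolP (sorted geq nu)) => [srt | /not_sorted_geq]; last first.
  move=> [A [a [b [B [enu ab]]]]].
  have [g' [h' eq_nu]] := composition_swap qq' (etrans (esym (congr1 sumn enu)) hn).
  rewrite enu eq_nu; set m' := m_elt _ _ _.
  have -> : g * (g' * m' * h') * h = (g * g') * m' * (h' * h) by rewrite !mulrA.
  have eba : [:: b, a & B] = [:: (a + (b - a))%N, (b - (b - a))%N & B].
    by congr [:: _, _ & _]; lia.
  apply: IHdom; rewrite eba ?enu.
  - by rewrite sumn_move ?leq_subr // -enu.
  - by rewrite row_weight_move //; lia.
  - by apply: dominates_move; lia.
have pnu : is_partition n nu by [].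
have move_case d t : (1 <= d < size nu)%N -> (1 <= t <= nth 0%N nu d)%N ->
    exists g' la, [/\ m_elt q n nu * h_elt q n nu d t = g' * m_elt q n la,
      sumn la = n & forall g h, P (g * m_elt q n la * h)].
  case: d => // r /= hr ht.
  have enu := split_at hr; set A := take r nu in enu; set B := drop _ _ in enu.
  set a := nth 0%N nu r in enu; set b := nth 0%N nu r.+1 in enu ht.
  have hn1 : sumn (A ++ [:: a, b & B]) = n by rewrite -enu.
  have tb : (t <= b)%N by lia.
  have [g2 e2] := composition_move tb hn1.
  exists g2, (A ++ [:: (a + t)%N, (b - t)%N & B]); split.
  - rewrite /h_elt /= -/A -/a C_elt_shuffles; last first.
      by rewrite -hn1 sumn_cat /=; lia.
    by rewrite [in m_elt q n nu]enu e2.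
  - by rewrite sumn_move.
  apply: IHdom; rewrite ?sumn_move // ?enu.
    by rewrite row_weight_move //; lia.
  exact: dominates_move.
have hm la : sumn la = n -> hstar (m_elt q n la) = m_elt q n la.
  by move=> hla; rewrite m_eltE // hstar_parab_sum.
have half w g' : incr (row_of nu) w -> col_incr nu w ->
    P (g' * m_elt q n nu * Tw w).
  move=> iw cw; suff hx (x : H) : P (hstar (m_elt q n nu * x) * Tw w).
    by have := hx (hstar g'); rewrite hstarM hm // hstarK.
  apply: (straighten qq' (P := fun z => P (hstar z * Tw w)) pnu).
  - exact: submodule_hstar (submodule_mulr (Tw w) hP).
  - by move=> u iu cu; rewrite hstarM hm //; apply: hstd => // j; apply: leqnn.
  move=> d t z hd ht; have [g2 [la [-> hla hP']]] := move_case d t hd ht.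
  by rewrite !hstarM hm // !mulrA -(mulrA _ (hstar g2)).
rewrite -mulrA; apply: (straighten qq' (P := fun z => P (g * z)) pnu).
- exact: submodule_mull.
- by move=> w iw cw; rewrite mulrA; apply: half.
move=> d t x hd ht; have [g2 [la [-> hla hP']]] := move_case d t hd ht.
by rewrite !mulrA.
Qed.

End ComposedSums.

(** * Reading a tableau along columns *)

Section ColumnReading.
Context {n : nat} (mu : seq nat) (mu_part : is_partition n mu).
Implicit Types (u v w z : 'S_n) (k l : 'I_n).

Let mu_n : sumn mu = n. Proof. by case: mu_part. Qed.

Lemma rank_perm (key : 'I_n -> nat) : injective key ->
  exists w, forall k l, (w k < w l)%N = (key k < key l)%N.
Proof.
move=> key_inj; pose S k := [set l : 'I_n | (key l < key k)%N]%SET.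
have Slt k l : (key k < key l)%N -> (#|S k| < #|S l|)%N.
  move=> kl; apply: proper_card; apply/properP; split.
    by apply/fintype.subsetP => j; rewrite !inE; lia.
  by exists k; rewrite !inE ?ltnn.
have Sn k : (#|S k| < n)%N.
  apply: leq_trans (_ : #|[set: 'I_n]%SET| <= n)%N; last by rewrite cardsT card_ord.
  apply: proper_card; apply/properP; split.
    by apply/fintype.subsetP => j; rewrite !inE.
  by exists k; rewrite !inE ?ltnn.
have finj : injective (fun k => Ordinal (Sn k)).
  move=> k l /(congr1 val) /= e; apply: key_inj.
  by have [/Slt | /Slt | //] := ltngtP (key k) (key l); rewrite e ltnn.
exists (perm finj) => k l; rewrite !permE /=.
have [/Slt -> // | /Slt lt | /key_inj ->] := ltngtP (key k) (key l).
  by apply/negbTE; rewrite -leqNgt ltnW.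
by rewrite ltnn.
Qed.

Lemma column_reading : exists (w : 'S_n) (b : nat -> nat),
  [/\ monotone b, forall k, b (w k) = col_of mu k &
      forall k l, (w k < w l)%N = (col_of mu k < col_of mu l)%N ||
        (col_of mu k == col_of mu l) && (k < l)%N].
Proof.
have [k l|w hw] := @rank_perm (fun k => (col_of mu k * n + k)%N).
  move=> /(congr1 (fun m => m %% n)%N); rewrite !modnMDl !modn_small //.
  exact: val_inj.
have lex k l : (w k < w l)%N = (col_of mu k < col_of mu l)%N ||
    (col_of mu k == col_of mu l) && (k < l)%N.
  rewrite hw; have := ltn_ord k; have := ltn_ord l.
  case: (ltngtP (col_of mu k) (col_of mu l)) => [lt | gt | ->] /= h1 h2; last by rewrite ltn_add2l.
    have : (col_of mu k * n + n <= col_of mu l * n)%N.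
      by rewrite -mulSnr leq_mul2r lt orbT.
    lia.
  have : (col_of mu l * n + n <= col_of mu k * n)%N.
    by rewrite -mulSnr leq_mul2r gt orbT.
  lia.
exists w, (fun p => oapp (fun i : 'I_n => col_of mu ((w^-1)%g i)) n (insub p)).
split=> //; last by move=> k; rewrite valK /= permK.
move=> p p' pp'; case: (insubP 'I_n p') => [i' hi' ei' | hp'] /=.
  have hp : (p < n)%N by lia.
  rewrite (insubT (fun m => m < n)%N hp) /=.
  set k := (w^-1)%g _; set l := (w^-1)%g i'.
  have e := lex l k; rewrite !permKV /= in e; rewrite -ei' /= in pp'; lia.
case: (insubP 'I_n p) => [i hi ei | hp] //=.
set k := (w^-1)%g i; have kn : (k < sumn mu)%N by rewrite mu_n.
by have := row_colK kn; have := ltn_ord k; lia.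
Qed.

End ColumnReading.

Section Counting.
Implicit Types (mu nu : seq nat) (c j : nat).

Lemma count_col_of nu c : (\sum_(0 <= k < sumn nu) (c <= col_of nu k) =
  \sum_(a <- nu) (a - c))%N.
Proof.
elim: nu => [|a nu IH]; first by rewrite big_geq // big_nil.
rewrite big_cons /= (big_cat_nat (n := a)) ?leq_addr //=; congr addn.
  rewrite (eq_big_nat _ _ (F2 := fun k => nat_of_bool (c <= k)%N)); last first.
    by move=> k /andP [_ ->].
  elim: a => [|a IHa]; first by rewrite big_geq.
  by rewrite big_nat_recr //= IHa; case: leqP; lia.
rewrite -[X in index_iota X _]add0n big_addn addKn -IH; apply: eq_bigr => k _.
by rewrite ltnNge leq_addl /= addnK.
Qed.

Lemma sum_take_le nu c j :
  (sumn (take j nu) <= \sum_(a <- nu) (a - c) + j * c)%N.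
Proof.
elim: nu j => [|a nu IH] [|j] //=; rewrite big_cons mulSn.
by have := IH j; lia.
Qed.

Lemma sum_take_ge mu j : sorted geq mu ->
  (\sum_(a <- mu) (a - nth 0 mu j) + j * nth 0 mu j <= sumn (take j mu))%N.
Proof.
elim: mu j => [|a mu IH] j srt; first by rewrite big_nil nth_nil muln0.
have geqT : transitive geq by move=> x y z /= h1 h2; apply: leq_trans h2 h1.
have hall : all (geq a) mu := order_path_min geqT srt.
have smu : sorted geq mu := path_sorted srt.
case: j => [|j] /=.
  rewrite big_cons subnn mul0n addn0 add0n leqn0; apply/eqP/big1_seq => x /= hx.
  by apply/eqP; have /allP/(_ x hx) := hall; rewrite /= subn_eq0.
have ca : (nth 0 mu j <= a)%N.
  have [hj | hj] := ltnP j (size mu); last by rewrite nth_default.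
  by have /allP/(_ _ (mem_nth 0%N hj)) := hall.
rewrite big_cons mulSn; have := IH j smu; lia.
Qed.

End Counting.

(** * Vanishing and independence *)

Section Vanishing.
Context {R : comPzRingType} (q q' : R) (qq' : q * q' = 1) {n : nat}.
Implicit Types (u v w z : 'S_n) (i j : 'I_n.-1) (k l : 'I_n) (b : nat -> nat).
Local Notation H := (hecke q n).
Local Notation s_ i := (simple_transp i).
Local Notation T i := (hT q i).
Local Notation Tw w := (hTw q w).

Lemma vanish_pair b b' z k l : monotone b -> monotone b' ->
  incr b z -> incr b' z^-1 -> (k < l)%N -> b k = b l -> b' (z k) = b' (z l) ->
  parab_sum q 1 b * Tw z * parab_sum q (- q') b' = 0.
Proof.
move=> mb mb' iz izV kl bkl bzkl.
have hk : (k.+1 < n)%N by apply: leq_ltn_trans kl _; apply: ltn_ord.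
have [i ei] := gen_exists hk.
have lok : lo i = k by apply: val_inj.
have b1 : b k = b k.+1.
  by apply/eqP; rewrite eqn_leq mb //= bkl mb.
have bi : b i = b i.+1 by rewrite ei.
have zi : ascent z i by apply: incr_ascent iz bi.
have zhl : (z (hi i) <= z l)%N.
  have [-> //|nl] := eqVneq (hi i) l; apply/ltnW/(elimT (incrP _ _) iz).
    by move: nl; rewrite -val_eqE /= ei; lia.
  by rewrite /= ei -b1.
move: (zi); rewrite /ascent lok => zk.
have b'h : b' (z (hi i)) = b' (z k).
  by apply/eqP; rewrite eqn_leq {1}bzkl !mb' //; apply: ltnW.
have zadj : z (hi i) = (z k).+1 :> nat.
  apply/eqP; rewrite eqn_leq zk andbT leqNgt; apply/negP => lt.
  have hv : ((z k).+1 < n)%N by apply: leq_trans lt _; apply/ltnW/ltn_ord.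
  pose v := Ordinal hv.
  have b'v : b' v = b' (z k).
    apply/eqP; rewrite eqn_leq -{1}b'h !mb' //=; lia.
  move/incrP: izV => inc; have h1 := inc (z k) v _ (esym b'v).
  have h2 := inc v (z (hi i)) lt (etrans b'v (esym b'h)).
  move: (h1 (leqnn _)) h2; rewrite !permK /= ei; lia.
have hzk : ((z k).+1 < n)%N by rewrite -zadj.
have [j ej] := gen_exists hzk.
have loj : lo j = z k by apply: val_inj.
have hij : hi j = z (hi i) by apply: val_inj; rewrite /= zadj ej.
have e : (s_ i * z = z * s_ j)%g.
  apply/permP => a; rewrite !permM /simple_transp -/(lo i) -/(hi i).
  rewrite -/(lo j) -/(hi j) loj hij lok.
  case: (tpermP k (hi i) a) => [->|->|/eqP ak /eqP ah]; rewrite ?tpermL ?tpermR //.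
  by rewrite tpermD // (inj_eq perm_inj) eq_sym.
have zj : ascent z^-1 j by rewrite /ascent loj hij !permK /= ei.
have b'j : b' j = b' j.+1 by rewrite ej -zadj b'h.
have [g ->] := parab_sum_factorr q 1 bi.
have [h ->] := parab_sum_factorl q (- q') b'j.
by rewrite scale1r !mulrA -(mulrA g) -(mulrA g) T_braid_zero // mulr0 mul0r.
Qed.

Lemma reduce_double b b' z : monotone b -> monotone b' -> exists z' (c : R),
  [/\ incr b z', incr b' z'^-1,
      parab_sum q 1 b * Tw z * parab_sum q (- q') b' =
      c *: (parab_sum q 1 b * Tw z' * parab_sum q (- q') b'),
      (inv z' <= inv z)%N & inv z' = inv z -> z' = z].
Proof.
move=> mb mb'; move: {2}(inv z) (leqnn (inv z)) => e.
elim: e z => [|e IH] z ze.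
  have -> : z = 1%g by apply: inv_eq0; lia.
  exists 1%g, 1; split; rewrite ?scale1r //.
    by apply/incrP => k l; rewrite !perm1.
  by rewrite invg1; apply/incrP => k l; rewrite !perm1.
case: (boolP (incr b z)) => [iz | /(incrN_descent mb) [i bi zi]]; last first.
  have ez := inv_simple_transpN zi.
  have [|z' [c [h1 h2 h3 h4 h5]]] := IH (s_ i * z)%g; first by lia.
  exists z', (q * c); split=> //; [ | by lia | by lia].
  by rewrite (hTw_descent _ zi) !mulrA parab_sum1_mul_T // -!hecke_scalerAl h3 scalerA.
case: (boolP (incr b' z^-1)) => [izV | /(incrN_descent mb') [j bj zj]]; last first.
  have ez := inv_simple_transpN zj.
  have ez' : inv z = (inv (z * s_ j)).+1.
    by rewrite -(invV (z * s_ j)) invMg simple_transpV -ez invV.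
  have [|z' [c [h1 h2 h3 h4 h5]]] := IH (z * s_ j)%g; first by lia.
  exists z', (- c); split=> //; [ | by lia | by lia].
  have -> : Tw z = Tw (z * s_ j)%g * T j.
    apply: (can_inj (@hstarK R q n)).
    by rewrite hstarM hstarT !hstar_hTw (hTw_descent _ zj) invMg simple_transpV.
  rewrite -!mulrA (T_mul_parab_sumN qq' bj) !mulrN mulrA h3 mulrA.
  exact/esym/scaleNr.
by exists z, 1; split; rewrite ?scale1r.
Qed.

Lemma sum_reindex (F : nat -> nat) z :
  (\sum_(k < n) F (z k) = \sum_(k < n) F k)%N.
Proof. by rewrite [RHS](reindex_inj (@perm_inj _ z)). Qed.

Lemma col_of_le (nu : seq nat) b' z : sumn nu = n -> monotone b' ->
  incr (row_of nu) z ->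
  (forall k l, (k < l)%N -> row_of nu k = row_of nu l -> b' (z k) <> b' (z l)) ->
  forall k, (col_of nu k <= b' (z k))%N.
Proof.
move=> hn mb' /incrP iz hno k.
have [c ec] : exists c, c = col_of nu k by exists (col_of nu k).
elim: c k ec => [|c IH] k ec; rewrite -ec //.
have kn : (k < sumn nu)%N by rewrite hn.
have kE := row_colK kn; rewrite -ec in kE.
have hk : (k.-1 < n)%N by have := ltn_ord k; lia.
pose k' := Ordinal hk.
have cl : (c < nth 0%N nu (row_of nu k))%N by have := col_of_lt kn; lia.
have k'E : k' = (sumn (take (row_of nu k) nu) + c)%N :> nat by rewrite /=; lia.
have rk' : row_of nu k' = row_of nu k by rewrite k'E row_of_pos.
have ck' : c = col_of nu k' by rewrite k'E col_of_pos.
have lt : (k' < k)%N by rewrite /=; lia.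
have := IH k' ck'; have := hno k' k lt rk'.
have := mb' (z k') (z k) (ltnW (iz _ _ lt rk')); rewrite -ck'; lia.
Qed.

Lemma sum_lt_of_strictly_dominates (mu nu : seq nat) : is_partition n mu ->
  strictly_dominates nu mu -> exists c,
  (\sum_(a <- mu) (a - c) < \sum_(a <- nu) (a - c))%N.
Proof.
move=> [srt _] /strictly_dominatesP [_ [j hj]]; exists (nth 0%N mu j).
have := sum_take_le nu (nth 0%N mu j) j; have := sum_take_ge j srt; lia.
Qed.

Section Fixed.
Context (mu : seq nat) (mu_part : is_partition n mu) (w : 'S_n) (b' : nat -> nat).
Context (mb' : monotone b') (b'w : forall k, b' (w k) = col_of mu k).
Context (lex : forall k l, (w k < w l)%N = (col_of mu k < col_of mu l)%N ||
  (col_of mu k == col_of mu l) && (k < l)%N).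

Local Notation X := (parab_sum q 1 (row_of mu)).
Local Notation Y := (parab_sum q (- q') b').

Lemma same_row_col (nu : seq nat) k l : sumn nu = n -> (k < l)%N ->
  row_of nu k = row_of nu l -> (col_of nu k < col_of nu l)%N.
Proof.
move=> hn kl e; have := @same_row nu k l; rewrite hn !ltn_ord.
by move=> /(_ isT isT e); lia.
Qed.

Lemma column_reading_incr : incr (row_of mu) w.
Proof.
apply/incrP => k l kl e; rewrite lex same_row_col //; by case: mu_part.
Qed.

Lemma column_reading_incrV : incr b' w^-1.
Proof.
apply/incrP => p p' pp' e; have := lex ((w^-1)%g p) ((w^-1)%g p').
by rewrite !permKV pp' -!b'w !permKV e ltnn eqxx /= => <-.
Qed.

Lemma vanish_dominating (nu : seq nat) (h : H) : is_partition n nu ->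
  strictly_dominates nu mu -> m_elt q n nu * h * Y = 0.
Proof.
move=> [_ hn] dom; move: h; apply: hTw_ind.
  split; first by rewrite mulr0 mul0r.
    by move=> x y ex ey; rewrite mulrDr mulrDl ex ey addr0.
  by move=> c x ex; rewrite -hecke_scalerAr -hecke_scalerAl ex scaler0.
move=> z; rewrite m_eltE //.
have mb := @monotone_row_of nu.
have [z' [c [h1 h2 -> _ _]]] := reduce_double z mb mb'.
suff -> : parab_sum q 1 (row_of nu) * Tw z' * Y = 0 by rewrite scaler0.
apply: contrapT => nz.
have hno k l : (k < l)%N -> row_of nu k = row_of nu l -> b' (z' k) <> b' (z' l).
  by move=> kl rkl bkl; apply: nz; apply: vanish_pair kl rkl bkl.
have hle := col_of_le hn mb' h1 hno.
have [d lt] := sum_lt_of_strictly_dominates mu_part dom.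
have mu_n : sumn mu = n by case: mu_part.
move: lt; rewrite -!count_col_of hn mu_n !big_mkord ltnNge => /negP; apply.
rewrite -[X in (_ <= X)%N](_ : \sum_(k < n) (d <= b' (z' k)) = _)%N.
  by apply: leq_sum => k _; have := hle k; case: leqP => //; case: leqP => //; lia.
rewrite (sum_reindex (fun p => d <= b' p)%N) -(sum_reindex (fun p => d <= b' p)%N w).
by apply: eq_bigr => k _; rewrite b'w.
Qed.

Lemma reduced_is_column_reading z : incr (row_of mu) z -> incr b' z^-1 ->
  (forall k l, (k < l)%N -> row_of mu k = row_of mu l -> b' (z k) <> b' (z l)) ->
  z = w.
Proof.
move=> iz izV hno; have mu_n : sumn mu = n by case: mu_part.
have hle := col_of_le mu_n mb' iz hno.
have heq k : col_of mu k = b' (z k).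
  have le_if l : true -> (col_of mu l <= b' (z l) ?= iff (col_of mu l == b' (z l)))%N.
    by move=> _; apply/leqif_eq/hle.
  have [_] := leqif_sum le_if; rewrite (sum_reindex b') -(sum_reindex b' w).
  rewrite (eq_bigr (fun l => b' (w l))); last by move=> l _; rewrite b'w.
  by rewrite eqxx => /esym/forallP/(_ k)/eqP.
have hu : (w^-1 * z)%g \in parab b'.
  apply/parabP => p; rewrite permM -heq -b'w permKV //.
have huV : (z^-1 * w)%g \in parab b' by have := parabV hu; rewrite invMg invgK.
have := @incr_parab_uniq n b' (z^-1 * w)%g 1%g w^-1 z^-1 mb' huV (parab1 _).
move=> /(_ column_reading_incrV izV); rewrite mul1g mulgK => /(_ erefl) [_ e].
by rewrite -(invgK z) -e invgK.
Qed.

Lemma vanish_short z : (inv z <= inv w)%N -> z <> w -> X * Tw z * Y = 0.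
Proof.
move=> zw nzw; have mb := @monotone_row_of mu.
have [z' [c [h1 h2 -> h4 h5]]] := reduce_double z mb mb'.
suff -> : X * Tw z' * Y = 0 by rewrite scaler0.
apply: contrapT => nz; have ez' : z' = w.
  apply: reduced_is_column_reading => // k l kl rkl bkl.
  by apply: nz; apply: vanish_pair kl rkl bkl.
apply: nzw; rewrite -ez' h5 // ez'; rewrite ez' in h4; lia.
Qed.

Lemma coef_column_reading : coef w (X * Tw w * Y) = 1.
Proof.
have mb := @monotone_row_of mu; have mu_n : sumn mu = n by case: mu_part.
have iwu u : u \in parab b' -> incr (row_of mu) (w * u)%g.
  move=> /parabP hu; apply/incrP => k l kl e; rewrite !permM ltnNge.
  apply/negP => /mb'; rewrite !hu !b'w; have := same_row_col mu_n kl e; lia.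
have -> : X * Tw w * Y = \sum_(u in parab b') (- q') ^+ inv u *:
    \sum_(v in parab (row_of mu)) Tw (v * (w * u))%g.
  rewrite {2}/parab_sum mulr_sumr; apply: eq_bigr => u hu.
  rewrite -hecke_scalerAr -mulrA -hTw_additive; last first.
    exact: inv_parab_mulr mb' hu column_reading_incrV.
  congr (_ *: _); rewrite /parab_sum mulr_suml; apply: eq_bigr => v hv.
  rewrite expr1n scale1r -hTw_additive //.
  exact: inv_parab_mul mb hv (iwu u hu).
have other u v : u \in parab b' -> v \in parab (row_of mu) ->
    w = (v * (w * u))%g -> v = 1%g /\ u = 1%g.
  move=> hu hv e.
  have := incr_parab_uniq mb (parab1 _) hv column_reading_incr (iwu u hu).
  rewrite mul1g => /(_ e) [<- e']; split=> //.
  by rewrite -(mulKg w u) -e' mulVg.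
rewrite (bigD1 (1%g : 'S_n)) ?parab1 //= coefD inv1 expr0 scale1r coef_sum.
rewrite (bigD1 (1%g : 'S_n)) ?parab1 //= coef_hTw mul1g mulg1 eqxx.
rewrite big1 ?addr0 => [|v /andP [hv v1]]; last first.
  rewrite coef_hTw; case: eqP => // e.
  by have [] := other 1%g v (parab1 _) hv; rewrite ?mulg1 // => e1; rewrite e1 eqxx in v1.
rewrite coef_sum big1 ?addr0 // => u /andP [hu u1].
rewrite coefZ coef_sum big1 ?mulr0 // => v hv; rewrite coef_hTw.
case: eqP => // e; have [_ e1] := other u v hu hv e.
by rewrite e1 eqxx in u1.
Qed.

Lemma standard_prefix v : incr (row_of mu) v -> col_incr mu v ->
  (inv v + inv (v^-1 * w))%N = inv w.
Proof.
move=> /incrP iv /col_incrP cv; apply: inv_additive.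
apply/fintype.subsetP => -[k l]; rewrite !inE /= => /andP [kl vlk].
rewrite kl lex /=; have [//|cle] := ltnP (col_of mu l) (col_of mu k).
have [srt mu_n] := mu_part.
have rle : (row_of mu k <= row_of mu l)%N by apply: monotone_row_of; apply: ltnW.
have [erow | nrow] := eqVneq (row_of mu k) (row_of mu l).
  by have := iv k l kl erow; lia.
have ln : (l < sumn mu)%N by rewrite mu_n.
have kn : (k < sumn mu)%N by rewrite mu_n.
have nle := nth_sorted_geq srt rle.
have cr : (col_of mu l < nth 0%N mu (row_of mu k))%N.
  by apply: leq_trans nle; apply: col_of_lt.
have hp := pos_lt cr; rewrite mu_n in hp; pose p := Ordinal hp.
have rp : row_of mu p = row_of mu k by apply: row_of_pos.
have cp : col_of mu p = col_of mu l by apply: col_of_pos.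
have : (v p < v l)%N by apply: cv => //; rewrite rp; lia.
have : (v k <= v p)%N.
  have [-> // | nk] := eqVneq k p; apply/ltnW/iv => //.
  have := row_colK kn; move: nk; rewrite -val_eqE /=; lia.
lia.
Qed.

Lemma standard_independent (c : 'S_n -> R) :
  (forall v, c v = 0 \/ incr (row_of mu) v /\ col_incr mu v) ->
  (forall h, (\sum_v c v *: (X * Tw v)) * h * Y = 0) ->
  forall v, c v = 0.
Proof.
move=> hc hx; suff : forall e v, (inv w < inv v + e)%N -> c v = 0.
  by move=> h v; apply: (h (inv w).+1); lia.
elim=> [|e IH] v hv.
  by case: (hc v) => // -[iv cv]; have := standard_prefix iv cv; lia.
case: (hc v) => // -[iv cv]; have pre := standard_prefix iv cv.
have := hx (Tw (v^-1 * w)%g); rewrite mulr_suml mulr_suml (bigD1 v) //=.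
rewrite big1 ?addr0 => [|u uv].
  rewrite -!hecke_scalerAl -(mulrA X) -hTw_additive mulKVg //.
  move=> /(congr1 (coef w)); rewrite coefZ coef_column_reading coef0 mulr1.
  exact.
have [lt | le] := ltnP (inv w) (inv u + e).
  by rewrite IH // scale0r !mul0r.
case: (hc u) => [-> | [iu cu]]; first by rewrite scale0r !mul0r.
rewrite -!hecke_scalerAl -(mulrA X).
suff -> : X * (Tw u * Tw (v^-1 * w)%g) * Y = 0 by rewrite scaler0.
apply: (@hTw_mul_ind R q n (fun h => X * h * Y = 0)).
- split; first by rewrite mulr0 mul0r.
    by move=> x y ex ey; rewrite mulrDr mulrDl ex ey addr0.
  by move=> d x ex; rewrite -hecke_scalerAr -hecke_scalerAl ex scaler0.
- move=> z lt; apply: vanish_short; first by lia.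
  by move=> ez; rewrite ez in lt; lia.
move=> ei; apply: vanish_short; first by lia.
move=> ez; move: uv; rewrite -(mulgK (v^-1 * w)%g u) ez invMg invgK mulgA mulgV.
by rewrite mul1g eqxx.
Qed.

End Fixed.

End Vanishing.

(** * The ideal *)

Section Spans.
Context {R : comPzRingType} (q : R) {n : nat}.
Local Notation H := (hecke q n).

Lemma span_submodule (S : set H) : submodule (Defs.span S).
Proof.
split.
- by exists 0%N, (fun=> 0), (fun=> 0); split; [case | rewrite big_ord0].
- move=> _ _ [k [c [v [hv ->]]]] [k' [c' [v' [hv' ->]]]].
  exists (k + k')%N,
    (fun i => match split i with inl i => c i | inr i => c' i end),
    (fun i => match split i with inl i => v i | inr i => v' i end).
  split; first by move=> i; case: split.
  rewrite big_split_ord; congr (_ + _); apply: eq_bigr => i _.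
    by rewrite (unsplitK (inl i)).
  by rewrite (unsplitK (inr i)).
- move=> a _ [k [c [v [hv ->]]]]; exists k, (fun i => a * c i), v; split=> //.
  by rewrite scaler_sumr; apply: eq_bigr => i _; rewrite scalerA.
Qed.

Lemma mem_span (S : set H) x : S x -> Defs.span S x.
Proof.
move=> Sx; exists 1%N, (fun=> 1), (fun=> x).
by split=> //; rewrite big_ord1 scale1r.
Qed.

Lemma span_ind (S : set H) (P : H -> Prop) : submodule P ->
  (forall x, S x -> P x) -> forall x, Defs.span S x -> P x.
Proof.
move=> hP hS _ [k [c [v [hv ->]]]]; apply: submodule_sum => // i _.
by case: hP => _ _ PZ; apply/PZ/hS.
Qed.

Lemma right_ideal_submodule (S : set H) : submodule (right_ideal S).
Proof.
split.
- by exists 0%N, (fun=> 0), (fun=> 0); split; [case | rewrite big_ord0].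
- move=> _ _ [k [v [a [hv ->]]]] [k' [v' [a' [hv' ->]]]].
  exists (k + k')%N,
    (fun i => match split i with inl i => v i | inr i => v' i end),
    (fun i => match split i with inl i => a i | inr i => a' i end).
  split; first by move=> i; case: split.
  rewrite big_split_ord; congr (_ + _); apply: eq_bigr => i _.
    by rewrite (unsplitK (inl i)).
  by rewrite (unsplitK (inr i)).
- move=> c _ [k [v [a [hv ->]]]]; exists k, v, (fun i => c *: a i).
  split=> //; rewrite scaler_sumr; apply: eq_bigr => i _.
  by rewrite hecke_scalerAr.
Qed.

Lemma mem_right_ideal (S : set H) x a : S x -> right_ideal S (x * a).
Proof.
by move=> Sx; exists 1%N, (fun=> x), (fun=> a); rewrite big_ord1.
Qed.

Lemma right_ideal_ind (S : set H) (P : H -> Prop) : submodule P ->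
  (forall x a, S x -> P (x * a)) -> forall x, right_ideal S x -> P x.
Proof.
move=> hP hS _ [k [v [a [hv ->]]]]; apply: submodule_sum => // i _.
exact: hS.
Qed.

Lemma M_mod_submodule (mu : seq nat) : submodule (M_mod q n mu).
Proof.
split; first by exists 0 => //; rewrite mulr0.
  by move=> _ _ [x _ <-] [y _ <-]; exists (x + y) => //; rewrite mulrDr.
by move=> c _ [x _ <-]; exists (c *: x) => //; rewrite hecke_scalerAr.
Qed.

End Spans.

Section Ideal.
Context {R : comPzRingType} (q q' : R) (qq' : q * q' = 1) {n : nat}.
Context (mu : seq nat) (mu_part : is_partition n mu).
Local Notation H := (hecke q n).

Definition ideal_gens : set H := [set x | exists d t : nat,
  [/\ (1 <= d < size mu)%N, (1 <= t <= nth 0%N mu d)%N &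
      x = m_elt q n mu * h_elt q n mu d t]].

Lemma ideal_gens_H_gt x a : ideal_gens x -> H_gt q n mu (x * a).
Proof.
have [srt mu_n] := mu_part.
case=> -[|r] [t [/= hr ht ->]] //.
have emu := split_at hr; set A := take r mu in emu; set B := drop _ _ in emu.
set c := nth 0%N mu r in emu; set b := nth 0%N mu r.+1 in emu ht.
have hn1 : sumn (A ++ [:: c, b & B]) = n by rewrite -emu.
have tb : (t <= b)%N by lia.
have [g e] := composition_move q tb hn1.
have -> : m_elt q n mu * h_elt q n mu r.+1 t =
    g * m_elt q n (A ++ [:: (c + t)%N, (b - t)%N & B]).
  rewrite /h_elt /= -/A -/c C_elt_shuffles; last first.
    by rewrite -hn1 sumn_cat /=; lia.
  have -> : m_elt q n mu = m_elt q n (A ++ [:: c, b & B]) by rewrite -emu.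
  exact: e.
apply: (composition_span qq'); first by rewrite sumn_move.
  exact: span_submodule.
move=> la u w la_part dom iu cu iw cw; apply: mem_span.
have [_ la_n] := la_part.
have [s hs <-] := Std_exists la_n iu cu.
have [s' hs' <-] := Std_exists la_n iw cw.
exists la, s, s'; split=> //.
by apply: dominates_strictly dom _; rewrite emu; apply: strictly_dominates_move.
Qed.

Lemma H_gt_vanish (w : 'S_n) (b' : nat -> nat) x h : monotone b' ->
  (forall k, b' (w k) = col_of mu k) -> H_gt q n mu x ->
  x * h * parab_sum q (- q') b' = 0.
Proof.
move=> mb' b'w; apply: (@span_ind R q n _ (fun x => x * h * _ = 0)).
  split; first by rewrite !mul0r.
    by move=> y z ey ez; rewrite !mulrDl ey ez addr0.
  by move=> c y ey; rewrite -!hecke_scalerAl ey scaler0.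
move=> _ [nu [s [t [nu_part dom _ _ ->]]]]; rewrite /m_basis.
have := vanish_dominating qq' mu_part mb' b'w (hTw q (tab_perm n t) * h) nu_part dom.
by move=> /(congr1 (fun z => hstar (hTw q (tab_perm n s)) * z)); rewrite mulr0 !mulrA.
Qed.

Lemma M_mod_H_gt x : M_mod q n mu x -> H_gt q n mu x -> right_ideal ideal_gens x.
Proof.
have [srt mu_n] := mu_part.
have [w [b' [mb' b'w lex]]] := column_reading mu_part.
move=> [h _ <-] hgt.
pose I := right_ideal ideal_gens.
have I_sub : submodule I by apply: right_ideal_submodule.
pose std (v : 'S_n) := incr (row_of mu) v && col_incr mu v.
pose P z := exists i (c : 'S_n -> R), [/\ I i, forall v, c v = 0 \/ std v &
  z = i + \sum_v c v *: (parab_sum q 1 (row_of mu) * hTw q v)].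
have P_sub : submodule P.
  case: (I_sub) => I0 ID IZ; split.
  - exists 0, (fun=> 0); split=> //; first by left.
    by rewrite big1 ?addr0 // => v _; rewrite scale0r.
  - move=> _ _ [i [c [Ii hc ->]]] [j [d [Ij hd ->]]].
    exists (i + j), (fun v => c v + d v); split; first exact: ID.
      move=> v; case: (hc v) => [-> | ]; last by right.
      by case: (hd v) => [-> | ]; [left; rewrite addr0 | right].
    rewrite addrACA; congr (_ + _); rewrite -big_split.
    by apply: eq_bigr => v _; rewrite scalerDl.
  - move=> a _ [i [c [Ii hc ->]]]; exists (a *: i), (fun v => a * c v).
    split; first exact: IZ.
      by move=> v; case: (hc v) => [-> | ]; [left; rewrite mulr0 | right].
    rewrite scalerDr scaler_sumr; congr (_ + _).
    by apply: eq_bigr => v _; rewrite scalerA.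
have [i [c [Ii hc e]]] : P (m_elt q n mu * h).
  apply: (straighten qq' mu_part P_sub).
    move=> v iv cv; exists 0, (fun u => (u == v)%:R); split.
    - by case: I_sub.
    - by move=> u; case: eqVneq => [-> | _]; [right; apply/andP | left].
    rewrite add0r (bigD1 v) //= eqxx scale1r m_eltE // big1 ?addr0 // => u.
    by move=> /negPf ->; rewrite scale0r.
  move=> d t a hd ht; exists (m_elt q n mu * h_elt q n mu d t * a), (fun=> 0).
  split; [|by left|].
    by apply: mem_right_ideal; exists d, t.
  by rewrite big1 ?addr0 // => v _; rewrite scale0r.
have i_gt : H_gt q n mu i.
  apply: right_ideal_ind Ii; first exact: span_submodule.
  by move=> *; apply: ideal_gens_H_gt.
have c0 : forall v, c v = 0.
  apply: (standard_independent qq' mu_part mb' b'w lex).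
    by move=> v; case: (hc v) => [-> | /andP]; [left | right].
  move=> a; apply: (H_gt_vanish _ mb' b'w).
  have -> : \sum_v c v *: (parab_sum q 1 (row_of mu) * hTw q v) =
      m_elt q n mu * h - i by rewrite e addrC addKr.
  by apply: submoduleB => //; apply: span_submodule.
rewrite e big1 ?addr0 // => v _; by rewrite c0 scale0r.
Qed.

End Ideal.

Theorem theorem2p3 (R : comPzRingType) (q : R)
    (q_inv : exists q' : R, q * q' = 1)
    (n : nat) (mu : seq nat) (mu_part : is_partition n mu) :
  right_ideal [set x | exists d t : nat,
      [/\ (1 <= d < size mu)%N, (1 <= t <= nth 0%N mu d)%N &
          x = m_elt q n mu * h_elt q n mu d t]] =
  M_mod q n mu `&` H_gt q n mu.
Proof.
have [q' qq'] := q_inv; apply/seteqP; split=> x; last first.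
  by move=> [Mx Hx]; exact: (M_mod_H_gt qq' mu_part Mx Hx).
move=> Ix; split.
  apply: right_ideal_ind Ix; first exact: M_mod_submodule.
  move=> _ a [d [t [_ _ ->]]]; exists (h_elt q n mu d t * a) => //.
  by rewrite mulrA.
apply: right_ideal_ind Ix; first exact: span_submodule.
by move=> y a hy; apply: (ideal_gens_H_gt qq').
Qed.
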